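(* Let $p\in[1,\infty)$, $I=[0,1]$, $0=x_0<x_1<\dots<x_N=1$, $u_i(x)=a_ix+b_i$ ($i\in\mathbb{N}_N$) affine with $u_i(0)=x_{i-1}$, $u_i(1)=x_i$, and $\alpha_i\in L^\infty(I)$ with $\Lambda:=\left(\sum_{i=1}^Na_i\|\alpha_i\|_\infty^p\right)^{1/p}<1$. Let $\{\lambda_i\}_{i\ge0}$ be distinct real numbers with $\lambda_i>-\frac1p$ for all $i$ and \[ \sum_{i=0}^\infty\frac{\lambda_i+\frac1p}{(\lambda_i+\frac1p)^2+1}=\infty. \] Then $S=\bigcup_{n=1}^\infty\bigcup_{m=1}^\infty\operatorname{span}\{(x^{\lambda_0})^\alpha_n,\dots,(x^{\lambda_m})^\alpha_n\}$ is dense in $L^p(I)$.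
   Context: The integral MKZ operator is $\widehat M_nh(x)=\int_0^1H_n(x,s)h(s)\,ds$, $H_n(x,s)=\sum_{k\ge0}\widehat m_{nk}(x)\chi_{I_k}(s)$, $\widehat m_{nk}(x)=(n+1)\binom{k+n+1}{k}x^k(1-x)^n$, $I_k=\left[\frac{k}{k+n},\frac{k+1}{k+n+1}\right]$. For $h\in L^p(I)$, $h^\alpha_n$ is the unique $G\in L^p(I)$ with $G=h+\sum_{i=1}^N(\alpha_i\circ u_i^{-1})((G-\widehat M_nh)\circ u_i^{-1})\chi_{u_i(I)}$; $(x^\lambda)^\alpha_n$ denotes this for $h(x)=x^\lambda$. *)

(* Defs.v *)
From HB Require Import structures.
From mathcomp Require Import all_boot all_order all_algebra.
From mathcomp Require Import all_classical all_reals all_analysis.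
Set Implicit Arguments. Unset Strict Implicit. Unset Printing Implicit Defensive.
Import Order.TTheory GRing.Theory Num.Theory.
Import numFieldNormedType.Exports.
Local Open Scope classical_set_scope.
Local Open Scope ring_scope.

Definition I01 {R : realType} : set R := `[0%R, 1%R]%classic.

Definition muI (R : realType) :=
  mrestr (@lebesgue_measure R) (measurable_itv `[0%R, 1%R]).
Arguments muI R : clear implicits.

Definition LpNorm {R : realType} (p : R) (f : R -> R) : \bar R :=
  Lnorm (muI R) p%:E (EFin \o f).
Definition LinfNorm {R : realType} (f : R -> R) : \bar R :=
  Lnorm (muI R) +oo%E (EFin \o f).

Definition inLp {R : realType} (p : R) (f : R -> R) : Prop :=
  measurable_fun I01 f /\ (LpNorm p f < +oo)%E.
Definition inLinf {R : realType} (f : R -> R) : Prop :=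
  measurable_fun I01 f /\ (LinfNorm f < +oo)%E.

Definition mhat {R : realType} (n k : nat) (x : R) : R :=
  n.+1%:R * ('C(k + n + 1, k))%:R * x ^+ k * (1 - x) ^+ n.

Definition Ik {R : realType} (n k : nat) : set R :=
  `[(k%:R / (k + n)%:R : R), ((k.+1)%:R / (k + n).+1%:R : R)]%classic.

Definition Hn {R : realType} (n : nat) (x s : R) : R :=
  limn (series (fun k => mhat n k x * \1_(Ik n k) s)).

Definition Mn {R : realType} (n : nat) (h : R -> R) (x : R) : R :=
  Rintegral (@lebesgue_measure R) I01 (fun s => Hn n x s * h s).

(* G is (a representative of) h^alpha_n : G in L^p(I) and
   G = h + sum_{i=1}^N (alpha_i o u_i^{-1}) ((G - M_n h) o u_i^{-1}) chi_{u_i(I)}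
   as elements of L^p(I), i.e. a.e. on I.  Here u_i(t) = a_i t + b_i. *)
Definition is_alpha_fractal {R : realType} (p : R) (N : nat) (a b : nat -> R)
  (alpha : nat -> R -> R) (n : nat) (h G : R -> R) : Prop :=
  inLp p G /\
  {ae (@lebesgue_measure R), forall y, I01 y ->
     G y = h y + \sum_(1 <= i < N.+1)
       (alpha i ((y - b i) / a i) *
        (G ((y - b i) / a i) - Mn n h ((y - b i) / a i)) *
        \1_((fun t => a i * t + b i) @` I01) y)}.

(* Main.v *)
Require Import Defs.
From HB Require Import structures.
From mathcomp Require Import all_boot all_order all_algebra.
From mathcomp Require Import all_classical all_reals all_analysis.
From mathcomp Require Import measurable_realfun ess_sup_inf.
From mathcomp Require Import ring lra.
Import Order.TTheory GRing.Theory Num.Theory.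
Import numFieldNormedType.Exports.
Local Open Scope classical_set_scope.
Local Open Scope ring_scope.

(** The perturbation [G - h] only involves [G - M_n h = (G - h) - (M_n h - h)]
on the pieces [u_i(I)], so that [‖G - h‖ <= Λ (‖G - h‖ + ‖M_n h - h‖)], i.e.
[‖G - h‖ <= Λ / (1 - Λ) ‖M_n h - h‖].  For [h = x^λ] the right-hand side tends
to [0]: split [|s^λ - x^λ| <= η (s^λ' + x^λ') + L |s - x|] with
[-1/p < λ' < min(λ, 0)], and bound the kernel average of [s^λ'] by a multiple of
[x^λ'] and that of [|s - x|] by the second moment of the negative binomial law.
It remains to prove the Müntz theorem in [L^p].  With [x = exp(-y)] and
[μ_j = λ_j + 1/p], it is enough to approximate [exp(-r y)] by combinations of the
[exp(-μ_j y)] uniformly with the weight [(1 + y)^2].  If the [μ_j >= 1] have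
[Σ 1/μ_j = oo], Golitschek's recursion does it for small [r].  Otherwise the
[μ_j < 1] have [Σ μ_j = oo]; then, with [z_j = 1 - μ_j], Blaschke factors
make [(1 - r)^n + Σ c_j z_j^n] small in [ℓ^2], and solving
[u_n' = u_(n+1) - u_n] from this datum yields exponential sums with exponents
[1 - z_j = μ_j] and the required decay in time.  Larger [r] are reached from
smaller ones, again by Golitschek's recursion. *)

Set Implicit Arguments.
Unset Strict Implicit.
Unset Printing Implicit Defensive.

(** * Divided differences and the factors of Golitschek *)

(** Working in a weighted sup norm on the half-line settles every finite p at once. The two regimes
    need different tools because Golitschek's factor [|mu - r| / (mu - r / 4)] is a gain only for mu
    comparable with r or larger. For exponents near 0 the divergence of Σ μ_j is a Blaschke
    condition: the generating function of z_j^n is 1 / (1 - z_j X), and such functions span the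
    Hardy space H^2 as soon as Σ (1 - z_j) diverges. Smallness in ℓ^2 only bounds the resulting
    exponential sum, without decay. Each further factor 1 - z_j = μ_j is a time derivative and gains
    (1 + t)^(-1/2), so four of them produce the weight (1 + t)^(-2). These factors are absorbed by
    the coefficients; that of the target becomes r^4, which is not 0. On the operator side x^λ may
    be unbounded at 0, where kernel averages are not uniformly close to it. Hence a modulus of
    continuity in two parts: one keeps the singular weight x^λ', which lies in L^p, the other is
    uniform in x. Only powers of x are treated, and finitely many of them: the combination is fixed
    before n. *)

Lemma ge0_derive_le {R : realType} (f df : R -> R) (a b : R) : a <= b ->
  (forall x, a <= x <= b -> is_derive x 1 f (df x)) ->
  (forall x, a <= x <= b -> 0 <= df x) -> f a <= f b.
Proof.
move=> ab fd df0.
have [||c] := @MVT_segment R f df a b ab.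
- by move=> x; rewrite in_itv/= => /andP[/ltW ? /ltW ?]; apply: fd; apply/andP.
- apply: derivable_within_continuous => x; rewrite in_itv/= => xab.
  by have [] := fd x xab.
rewrite in_itv/= => cab e; rewrite -subr_ge0 e mulr_ge0 ?df0//.
by rewrite subr_ge0.
Qed.

Lemma is_derive_sumF {R : realType} m (F dF : nat -> R -> R) (t : R) :
  (forall j, is_derive t 1 (F j) (dF j t)) ->
  is_derive t 1 (fun t => \sum_(j < m) F j t) (\sum_(j < m) dF j t).
Proof.
move=> FdF.
have -> : (fun t => \sum_(j < m) F j t) = \sum_(j < m) F j.
  by apply/funext => u; rewrite fct_sumE.
exact: is_derive_sum.
Qed.

Section is_derive_fun.
Context {R : realType}.
Implicit Types (f g : R -> R) (t df dg : R).

Lemma is_derive_funZ (c : R) f t df :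
  is_derive t 1 f df -> is_derive t 1 (fun u => c * f u) (c * df).
Proof. by move=> h; exact: (is_deriveZ c). Qed.

Lemma is_derive_funD f g t df dg : is_derive t 1 f df -> is_derive t 1 g dg ->
  is_derive t 1 (fun u => f u + g u) (df + dg).
Proof. by move=> h h'; exact: is_deriveD. Qed.

Lemma is_derive_funB f g t df dg : is_derive t 1 f df -> is_derive t 1 g dg ->
  is_derive t 1 (fun u => f u - g u) (df - dg).
Proof. by move=> h h'; exact: is_deriveB. Qed.

Lemma is_derive_funN f t df : is_derive t 1 f df ->
  is_derive t 1 (fun u => - f u) (- df).
Proof. by move=> h; exact: is_deriveN. Qed.

Lemma is_derive_funM f g t df dg : is_derive t 1 f df -> is_derive t 1 g dg ->
  is_derive t 1 (fun u => f u * g u) (f t * dg + g t * df).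
Proof. by move=> h h'; exact: is_deriveM. Qed.

End is_derive_fun.

Lemma is_derive_expRN {R : realType} (a t : R) :
  is_derive t 1 (fun t => expR (- a * t)) (- a * expR (- a * t)).
Proof.
have h : is_derive t 1 (fun t : R => - a * t) (- a).
  by apply: is_derive_eq; rewrite /GRing.scale /= mulr1.
have := is_derive1_comp (g:=fun t : R => - a * t) (f:=expR) (is_derive_expR _) h.
by move=> h'; apply: (is_derive_eq h'); rewrite mulrC.
Qed.

(* [exp(mu y)] is an integrating factor: [(exp(mu y) S)' = exp(mu y) Q]. *)
Lemma golitschek_half {R : realType} (Q S : R -> R) (mu b A : R) : b < mu ->
  (forall y : R, 0 <= y -> is_derive y 1 S (Q y - mu * S y)) -> S 0 = 0 ->
  (forall y : R, 0 <= y -> `|Q y| <= A * expR (- b * y)) ->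
  forall y, 0 <= y -> S y <= A / (mu - b) * expR (- b * y).
Proof.
move=> bmu dS S0 QA y y0.
have A0 : 0 <= A.
  by have := QA 0 (lexx _); rewrite mulr0 expR0 mulr1; apply: le_trans.
have mb : 0 < mu - b by rewrite subr_gt0.
(* This is exp(mu t) times the gap between the claimed bound and S; its derivative exp(mu t) (A
   exp(-b t) - Q t) is nonnegative. The exponents are written so as to match [is_derive_expRN]. *)
pose f t := A / (mu - b) * expR (- (b - mu) * t) - expR (- - mu * t) * S t.
have : f 0 <= f y.
  apply: (@ge0_derive_le R f (fun t => A / (mu - b) * (- (b - mu) * expR (- (b - mu) * t))
    - (expR (- - mu * t) * (Q t - mu * S t) + S t * (- - mu * expR (- - mu * t)))) 0 y y0).
    move=> t /andP[t0 ty]; rewrite /f.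
    have d1 := is_derive_expRN (b - mu) t.
    have d2 := is_derive_expRN (- mu) t.
    have d3 := dS t t0.
    exact: is_derive_funB (is_derive_funZ _ d1) (is_derive_funM d2 d3).
  move=> t /andP[t0 ty].
  have -> : A / (mu - b) * (- (b - mu) * expR (- (b - mu) * t))
    - (expR (- - mu * t) * (Q t - mu * S t) + S t * (- - mu * expR (- - mu * t)))
    = A * expR (- (b - mu) * t) - expR (- - mu * t) * Q t.
    by field; rewrite gt_eqF.
  have -> : - (b - mu) * t = - - mu * t + - b * t by ring.
  rewrite expRD subr_ge0 mulrCA ler_pM2l ?expR_gt0//.
  by apply: le_trans (ler_norm _) _; exact: QA.
rewrite /f !mulr0 expR0 S0 mulr0 subr0 mulr1 => /(le_trans (divr_ge0 A0 (ltW mb))).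
have -> : - (b - mu) * y = - - mu * y + - b * y by ring.
by rewrite expRD subr_ge0 mulrCA ler_pM2l ?expR_gt0.
Qed.

Lemma golitschek_bound {R : realType} (Q S : R -> R) (mu b A : R) : b < mu ->
  (forall y : R, 0 <= y -> is_derive y 1 S (Q y - mu * S y)) -> S 0 = 0 ->
  (forall y : R, 0 <= y -> `|Q y| <= A * expR (- b * y)) ->
  forall y : R, 0 <= y -> `|S y| <= A / (mu - b) * expR (- b * y).
Proof.
move=> bmu dS S0 QA y y0; rewrite ler_norml; apply/andP; split; last first.
  exact: (@golitschek_half _ Q S).
rewrite lerNl.
apply: (@golitschek_half _ (fun t => - Q t) (fun t => - S t) mu b A) => //.
- move=> t t0; have -> : - Q t - mu * - S t = - (Q t - mu * S t) by ring.
  exact: is_derive_funN (dS t t0).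
- by rewrite S0 oppr0.
- by move=> t t0; rewrite normrN QA.
Qed.

(** Both signs of mu - r give |mu - r| <= mu - r/2: for mu < r this says exactly 4 mu >= 3 r, whence
    the hypothesis. The right-hand side times mu - r/4 exceeds mu - r/2 by r^2 / (16 mu). Admitting
    exponents slightly below r is what later allows r to grow. *)
Lemma golitschek_factor {R : realType} (mu r : R) : 0 < r -> 3 * r <= 4 * mu ->
  `|mu - r| / (mu - r / 4) <= 1 - r / (4 * mu).
Proof.
move=> r0 rmu.
have mu0 : 0 < mu by lra.
have d0 : 0 < mu - r / 4 by lra.
rewrite ler_pdivrMr//.
have -> : (1 - r / (4 * mu)) * (mu - r / 4) = mu - r / 2 + r ^+ 2 / (16 * mu).
  by field; rewrite gt_eqF.
have : 0 <= r ^+ 2 / (16 * mu) by rewrite divr_ge0 ?sqr_ge0//; lra.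
by case: (lerP r mu) => h; lra.
Qed.

Section golitschek.
Context {R : realType}.
Variables (nu : nat -> R) (M : R).
Hypothesis nu_inj : injective nu.
Hypothesis nu0 : 0 < nu 0%N.
Hypothesis nuM : 3 * nu 0%N <= 4 * M.

Let r := nu 0%N.
(** [nu 0] is the target r and the [nu j.+1] are the available exponents. Those below M are skipped:
    coefficient 0 and gain 0, so that the given enumeration is kept. *)
Let f j := if M <= nu j.+1 then r / (4 * nu j.+1) else 0.

(* Golitschek's recursion: a new exponent [mu] replaces the sum [Q] by
   [(mu - r) S], where [S' = Q - mu S] and [S 0 = 0]. This keeps the coefficient
   of [exp(-r y)] equal to [1] and multiplies the bound by [|mu - r| / (mu - r/4)]. *)
Lemma golitschek_approx m : exists c : nat -> R, c 0%N = 1 /\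
  forall y, 0 <= y ->
  `|\sum_(j < m.+1) c j * expR (- nu j * y)| <=
    (\prod_(j < m) (1 - f j)) * expR (- (r / 4) * y).
Proof.
elim: m => [|m [c [c0 IH]]].
  exists (fun=> 1); split=> // y y0; rewrite big_ord_recl !big_ord0 addr0 !mul1r.
  rewrite ger0_norm ?expR_ge0// ler_expR -/r ler_wpM2r//.
  by have : 0 < r by []; lra.
rewrite big_ord_recr/= {2}/f; case: ifPn => Mnu; last first.
  exists (fun j => if (j < m.+1)%N then c j else 0); split => // y y0.
  rewrite big_ord_recr/= ltnn mul0r addr0 subr0 mulr1.
  by under eq_bigr => j _ do rewrite ltn_ord; exact: IH.
pose mu := nu m.+1.
have r0 : 0 < r by [].
have rb : 3 * r <= 4 * mu by apply: (le_trans nuM); rewrite ler_pM2l.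
have ne j : (j < m.+1)%N -> mu - nu j != 0.
  by move=> jm; rewrite subr_eq0; apply/eqP => /nu_inj e; rewrite e ltnn in jm.
pose S y := \sum_(j < m.+1) c j / (mu - nu j) * (expR (- nu j * y) - expR (- mu * y)).
pose Q y := \sum_(j < m.+1) c j * expR (- nu j * y).
have Sb : forall y : R, 0 <= y -> `|S y| <=
    (\prod_(j < m) (1 - f j)) / (mu - r / 4) * expR (- (r / 4) * y).
  apply: (@golitschek_bound _ Q) => //.
  - lra.
  - move=> t t0.
    have H : is_derive t 1 S (\sum_(j < m.+1)
        c j / (mu - nu j) * (- nu j * expR (- nu j * t) - (- mu * expR (- mu * t)))).
      apply: (@is_derive_sumF R _
        (fun j y => c j / (mu - nu j) * (expR (- nu j * y) - expR (- mu * y)))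
        (fun j t => c j / (mu - nu j) *
           (- nu j * expR (- nu j * t) - (- mu * expR (- mu * t))))) => j.
      exact: is_derive_funZ
        (is_derive_funB (is_derive_expRN _ _) (is_derive_expRN _ _)).
    apply: (is_derive_eq H).
    rewrite /S /Q mulr_sumr -sumrB; apply: eq_bigr => j _.
    by field; exact: ne.
  - by rewrite /S; apply: big1 => j _; rewrite !mulr0 subrr mulr0.
exists (fun j => if (j < m.+1)%N then (mu - r) * (c j / (mu - nu j))
   else - ((mu - r) * \sum_(i < m.+1) c i / (mu - nu i))); split.
  by rewrite /= c0 -/r mul1r divff// (ne 0%N).
move=> y y0.
have -> : \sum_(j < m.+2) (if (j < m.+1)%N then (mu - r) * (c j / (mu - nu j))
   else - ((mu - r) * \sum_(i < m.+1) c i / (mu - nu i))) * expR (- nu j * y)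
   = (mu - r) * S y.
  rewrite big_ord_recr/= ltnn -/mu /S.
  have -> : \sum_(j < m.+1) c j / (mu - nu j) * (expR (- nu j * y) - expR (- mu * y))
    = \sum_(j < m.+1) c j / (mu - nu j) * expR (- nu j * y)
      - (\sum_(j < m.+1) c j / (mu - nu j)) * expR (- mu * y).
    by rewrite mulr_suml -sumrB; apply: eq_bigr => j _; rewrite mulrBr.
  rewrite mulrBr mulrA mulNr; congr (_ - _); rewrite [RHS]mulr_sumr.
  by apply: eq_bigr => j _; rewrite ltn_ord -!mulrA.
rewrite normrM.
apply: (le_trans (ler_wpM2l (normr_ge0 (mu - r)) (Sb _ y0))).
rewrite mulrA ler_wpM2r ?expR_ge0// mulrCA ler_wpM2l ?golitschek_factor//.
by have := IH 0 (lexx _); rewrite !mulr0 expR0 mulr1; apply: le_trans.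
Qed.

End golitschek.

(** * Blaschke products and smoothing in the sequence space *)

(* As generating functions, [q = w / (1 - z X)] and [u = (X - z) / (1 - z X) w]. *)
Lemma blaschke_contraction {R : realType} (w q u : nat -> R) (z : R) :
  z ^+ 2 <= 1 -> q 0%N = w 0%N -> (forall k, q k.+1 = z * q k + w k.+1) ->
  u 0%N = - z * q 0%N -> (forall k, u k.+1 = q k - z * q k.+1) ->
  forall K, \sum_(k < K) u k ^+ 2 <= \sum_(k < K) w k ^+ 2.
Proof.
move=> z1 q0 qS u0 uS [|K]; first by rewrite !big_ord0.
(* Finite form of the isometry of a Blaschke factor on H^2: cutting the sums at K leaves an explicit
   nonnegative defect. *)
suff : \sum_(k < K.+1) w k ^+ 2 - \sum_(k < K.+1) u k ^+ 2 = (1 - z ^+ 2) * q K ^+ 2.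
  by rewrite -subr_ge0 => ->; rewrite mulr_ge0 ?sqr_ge0 ?subr_ge0.
elim: K => [|K IH]; first by rewrite !big_ord1 u0 -q0; ring.
rewrite big_ord_recr/= [X in _ - X]big_ord_recr/= opprD addrACA IH uS qS.
have -> : w K.+1 = q K.+1 - z * q K by rewrite qS addrC addKr.
by rewrite qS; ring.
Qed.

Lemma geometric_sqr_sum {R : realType} (z : R) K : z ^+ 2 < 1 ->
  \sum_(k < K) (z ^+ k) ^+ 2 <= (1 - z ^+ 2)^-1.
Proof.
move=> z1; have d0 : 0 < 1 - z ^+ 2 by rewrite subr_gt0.
rewrite -[leRHS]mul1r ler_pdivlMr//.
suff -> : (\sum_(k < K) (z ^+ k) ^+ 2) * (1 - z ^+ 2) = 1 - (z ^+ K) ^+ 2.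
  by rewrite gerBl sqr_ge0.
elim: K => [|K IH]; first by rewrite big_ord0; ring.
by rewrite big_ord_recr/= mulrDl IH [z ^+ K.+1]exprS; ring.
Qed.

Section blaschke.
Context {R : realType}.
Variable z : nat -> R.
Hypothesis z_inj : injective z.
Hypothesis z0 : 0 <= z 0%N < 1.

Let f j := if 0 < z j.+1 < 1 then (1 - z 0%N ^+ 2) * (1 - z j.+1) else 0.

(** With a = [z 0], (1 - ta)^2 - (a - t)^2 = (1 - a^2)(1 - t^2), while (1 - ta)^2 <= 1 <= 1 + t. The
    loss from 1 is thus at least a fixed multiple of 1 - t, and divergence of Σ (1 - z_j) drives the
    product to 0. *)
Lemma blaschke_factor (t : R) : 0 < t < 1 ->
  ((z 0%N - t) / (1 - t * z 0%N)) ^+ 2 <= 1 - (1 - z 0%N ^+ 2) * (1 - t).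
Proof.
move=> /andP[t0 t1]; have /andP[a0 a1] := z0.
set a := z 0%N in a0 a1 *.
have ta0 : 0 <= t * a by apply: mulr_ge0 => //; exact: ltW.
have ta1 : t * a < 1 by rewrite mulr_ilt1 // ltW.
have d0 : 0 < 1 - t * a by rewrite subr_gt0.
rewrite expr_div_n ler_pdivrMr ?exprn_gt0//.
have h1 : 0 <= 1 - a ^+ 2 by rewrite subr_ge0 expr_le1// ltW.
have h2 : (1 - t * a) ^+ 2 <= 1 by rewrite expr_le1//; lra.
have h3 : (1 - t) * (1 - t * a) ^+ 2 <= (1 - t) * (1 + t).
  by apply: ler_wpM2l; lra.
have := ler_wpM2l h1 h3.
have -> : (1 - a ^+ 2) * ((1 - t) * (1 + t)) = (1 - t * a) ^+ 2 - (a - t) ^+ 2 by ring.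
by lra.
Qed.

(* Each step applies the Blaschke factor of [z m.+1], which preserves the [ℓ^2] bound
   but multiplies the coefficient of [z 0 ^+ k] by [kap^-1]; multiplying by [kap]
   restores the coefficient [1] and gains the factor [kap ^+ 2]. *)
Lemma blaschke_approx m : exists c : nat -> R, [/\ c 0%N = 1,
  forall j, c j != 0 -> `|z j| < 1 &
  forall K, \sum_(k < K) (\sum_(j < m.+1) c j * z j ^+ k) ^+ 2 <=
    (\prod_(j < m) (1 - f j)) / (1 - z 0%N ^+ 2)].
Proof.
have /andP[a0 a1] := z0.
have na1 : `|z 0%N| < 1 by rewrite ger0_norm.
have sa1 : z 0%N ^+ 2 < 1 by rewrite expr_lt1.
elim: m => [|m [c [c0 supp IH]]].
  exists (fun j => (j == 0%N)%:R); split => // [[|j]//|]; rewrite ?eqxx//.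
  move=> K; rewrite big_ord0 mul1r.
  by under eq_bigr do rewrite big_ord1/= mul1r; exact: geometric_sqr_sum.
rewrite big_ord_recr/= {2}/f; case: ifPn => t01; last first.
  exists (fun j => if (j < m.+1)%N then c j else 0); split => //.
    by move=> j; case: ifP => [_ /supp//|]; rewrite eqxx.
  move=> K; rewrite subr0 mulr1.
  under eq_bigr => k _.
    rewrite big_ord_recr/= ltnn mul0r addr0.
    under eq_bigr => j _ do rewrite ltn_ord.
    over.
  exact: IH.
set t := z m.+1 in t01 *.
have ne j : (j < m.+1)%N -> z j - t != 0.
  by move=> jm; rewrite subr_eq0; apply/eqP => /z_inj e; rewrite e ltnn in jm.
have /andP[t0 t1] := t01.
have d0 : 0 < 1 - t * z 0%N by rewrite subr_gt0 mulr_ilt1// ltW.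
pose w k := \sum_(j < m.+1) c j * z j ^+ k.
(* Closed forms: the convolution of z_j^k with t^k is a divided difference, and by partial fractions
   [u] is again a combination of the z_j^k and t^k. *)
pose q k := \sum_(j < m.+1) c j * ((z j ^+ k.+1 - t ^+ k.+1) / (z j - t)).
pose u k := \sum_(j < m.+1) c j *
  (((1 - t * z j) * z j ^+ k - (1 - t ^+ 2) * t ^+ k) / (z j - t)).
have uw : forall K, \sum_(k < K) u k ^+ 2 <= \sum_(k < K) w k ^+ 2.
  apply: (@blaschke_contraction _ w q u t).
  - by rewrite expr_le1// ltW.
  - by apply: eq_bigr => j _; field; exact: ne.
  - move=> k; rewrite mulr_sumr -big_split/=; apply: eq_bigr => j _.
    by rewrite !exprS; field; exact: ne.
  - by rewrite mulr_sumr; apply: eq_bigr => j _; field; exact: ne.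
  - move=> k; rewrite mulr_sumr -sumrB; apply: eq_bigr => j _.
    by rewrite !exprS; field; exact: ne.
pose kap := (z 0%N - t) / (1 - t * z 0%N).
pose c' j := if (j < m.+1)%N then kap * (c j * (1 - t * z j) / (z j - t))
   else if j == m.+1 then
     - (kap * ((1 - t ^+ 2) * \sum_(i < m.+1) c i / (z i - t))) else 0.
exists c'; split.
- by rewrite /c' /= c0 /kap mul1r mulrA divfK ?gt_eqF// divff// (ne 0%N).
- move=> j; rewrite /c'; case: ifPn => [_ |_].
    by rewrite !mulf_eq0 !negb_or => /andP[_ /andP[/andP[/supp]]].
  case: ifPn; last by rewrite eqxx.
  by move=> /eqP-> _; rewrite -/t ger0_norm// ltW.
move=> K.
have cu k : \sum_(j < m.+2) c' j * z j ^+ k = kap * u k.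
  rewrite big_ord_recr/= /c' ltnn eqxx -/t.
  under eq_bigr => j _ do rewrite ltn_ord.
  rewrite /u mulr_sumr mulNr !mulr_sumr mulr_suml -sumrB; apply: eq_bigr => j _.
  by field; exact: ne.
under eq_bigr do rewrite cu exprMn.
rewrite -mulr_sumr mulrC [leRHS]mulrAC; apply: ler_pM.
- by apply: sumr_ge0 => k _; exact: sqr_ge0.
- exact: sqr_ge0.
- exact: le_trans (uw K) (IH K).
- exact: blaschke_factor.
Qed.

End blaschke.

(** * Decay in time for the flow u_n' = u_(n+1) - u_n *)

Section smoothing.
Context {R : realType}.
Variables (m : nat) (c z : nat -> R).
Hypothesis supp : forall j, c j != 0 -> `|z j| < 1.

Let u i n (t : R) := \sum_(j < m)
  c j * (1 - z j) ^+ i * z j ^+ n * expR (- (1 - z j) * t).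
Let E i K t := \sum_(n < K) u i n t ^+ 2.

Let uS i n t : u i n.+1 t = u i n t - u i.+1 n t.
Proof.
by rewrite /u -sumrB; apply: eq_bigr => j _; rewrite !exprS; ring.
Qed.

Let u_derive i n (t : R) : is_derive t 1 (u i n) (- u i.+1 n t).
Proof.
have H : is_derive t 1 (u i n) (\sum_(j < m) c j * (1 - z j) ^+ i * z j ^+ n *
   (- (1 - z j) * expR (- (1 - z j) * t))).
  apply: (@is_derive_sumF R _
    (fun j t => c j * (1 - z j) ^+ i * z j ^+ n * expR (- (1 - z j) * t))
    (fun j t => c j * (1 - z j) ^+ i * z j ^+ n *
      (- (1 - z j) * expR (- (1 - z j) * t)))) => j.
  exact: is_derive_funZ (is_derive_expRN _ _).
apply: (is_derive_eq H); rewrite /u -sumrN; apply: eq_bigr => j _.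
by rewrite exprS; ring.
Qed.

(** With a = u_n and b = u_(n+1), the derivative of u_n^2 is -2 a (a - b) = b^2 - a^2 - (a - b)^2.
    The first two terms telescope in n; the last is the square summed in [E i.+1]. *)
Let E_derive i K (t : R) :
  is_derive t 1 (E i K) (u i K t ^+ 2 - u i 0%N t ^+ 2 - E i.+1 K t).
Proof.
have H : is_derive t 1 (E i K) (\sum_(n < K)
   (u i n t * (- u i.+1 n t) + u i n t * (- u i.+1 n t))).
  apply: (@is_derive_sumF R _ (fun n t => u i n t ^+ 2)
    (fun n t => u i n t * (- u i.+1 n t) + u i n t * (- u i.+1 n t))) => n.
  exact: is_derive_funM (u_derive i n t) (u_derive i n t).
apply: (is_derive_eq H); rewrite /E.
elim: K {H} => [|K IH]; first by rewrite !big_ord0; ring.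
by rewrite big_ord_recr/= IH big_ord_recr/= uS; ring.
Qed.

Let E_ge0 i K t : 0 <= E i K t.
Proof. by apply: sumr_ge0 => n _; exact: sqr_ge0. Qed.

(** Only finitely many z_j occur with a nonzero coefficient, all with |z_j| < 1, and exp(-(1 - z_j)
    t) <= 1 makes the decay in K uniform in t. *)
Let u_small i (e : R) : 0 < e ->
  \forall K \near \oo, forall t, 0 <= t -> u i K t ^+ 2 <= e.
Proof.
move=> e0.
pose D K := \sum_(j < m) `|c j * (1 - z j) ^+ i| * `|z j| ^+ K.
have D_cvg : D K @[K --> \oo] --> 0.
  rewrite -[X in _ --> X](@big1 R 0 +%R 'I_m (index_enum _) xpredT (fun=> 0))//.
  apply: cvg_big => [|j _]; first exact: add_continuous.
  have [cj0|cj0] := eqVneq (c j) 0.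
    by under eq_cvg do rewrite cj0 mul0r normr0 mul0r; exact: cvg_cst.
  rewrite -[X in _ --> X](mulr0 `|c j * (1 - z j) ^+ i|).
  by apply: cvgMr; apply: cvg_expr; rewrite normr_id supp.
have [s [s0 se]] : exists s : R, 0 < s /\ s ^+ 2 <= e.
  exists (Num.sqrt e); rewrite sqrtr_gt0 e0; split => //.
  by rewrite sqr_sqrtr// ltW.
have /cvgr0_norm_le/(_ _ s0) := D_cvg.
apply: filterS => K DK t t0; apply: le_trans se.
rewrite -real_normK ?num_real// ler_pXn2r ?nnegrE//; last exact: ltW.
apply: le_trans DK; rewrite [leRHS]ger0_norm; last first.
  by apply: sumr_ge0 => j _; rewrite mulr_ge0// exprn_ge0.
rewrite /u; apply: le_trans (ler_norm_sum _ _ _) _; apply: ler_sum => j _.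
have [cj0|cj0] := eqVneq (c j) 0.
  by rewrite cj0 !(mul0r,normr0).
rewrite !normrM !normrX ler_piMr ?mulr_ge0 ?exprn_ge0//.
rewrite ger0_norm ?expR_ge0// expR_le1 mulNr oppr_le0 mulr_ge0// subr_ge0.
by rewrite (le_trans (ler_norm _))// ltW// supp.
Qed.

(* [u 0] solves [u_n' = u_(n+1) - u_n], and each [u i.+1] is minus the time
   derivative of [u i]. The combination [F] of the energies [E i] with weights
   [(1 + t) ^ i / i!] is nonincreasing up to the terms at the right end [n = K],
   which vanish in the limit. *)
Lemma heat_smoothing (P : R) :
  (forall K, \sum_(n < K) (\sum_(j < m) c j * z j ^+ n) ^+ 2 <= P) ->
  forall t, 0 <= t ->
  `|\sum_(j < m) c j * (1 - z j) ^+ 4 * expR (- (1 - z j) * t)|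
     <= 29 * Num.sqrt P / (1 + t) ^+ 2.
Proof.
move=> cP y y0.
(* The difference operator has norm at most 2 on ℓ^2, by (a - b)^2 <= 2 a^2 + 2 b^2. The hypothesis
   holds for all K, so the shift by one index is harmless. *)
have E0 i K : E i K 0 <= 4 ^+ i * P.
  elim: i K => [|i IH] K.
    rewrite mul1r; apply: le_trans (cP K); rewrite le_eqVlt; apply/orP; left.
    apply/eqP; apply: eq_bigr => n _; congr (_ ^+ 2); apply: eq_bigr => j _.
    by rewrite mulr0 expR0 expr0 !mulr1.
  have := IH K.+1.
  have -> : E i K.+1 0 = \sum_(n < K) u i n 0 ^+ 2 + u i K 0 ^+ 2.
    by rewrite /E big_ord_recr.
  have := IH K.+1.
  have -> : E i K.+1 0 = u i 0%N 0 ^+ 2 + \sum_(n < K) u i n.+1 0 ^+ 2.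
    by rewrite /E big_ord_recl.
  have : E i.+1 K 0 <= 2 * \sum_(n < K) u i n 0 ^+ 2
      + 2 * \sum_(n < K) u i n.+1 0 ^+ 2.
    rewrite !mulr_sumr -big_split; apply: ler_sum => n _ /=.
    have -> : u i.+1 n 0 = u i n 0 - u i n.+1 0 by rewrite uS; ring.
    rewrite -subr_ge0.
    have -> : 2 * u i n 0 ^+ 2 + 2 * u i n.+1 0 ^+ 2 - (u i n 0 - u i n.+1 0) ^+ 2
       = (u i n 0 + u i n.+1 0) ^+ 2 by ring.
    exact: sqr_ge0.
  rewrite [4 ^+ i.+1]exprS -[4 * 4 ^+ i * P]mulrA.
  by have := sqr_ge0 (u i K 0); have := sqr_ge0 (u i 0%N 0); lra.
have P0 : 0 <= P by have := cP 0%N; rewrite big_ord0.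
pose F K t := E 0%N K t + ((1 + t) * E 1%N K t + ((1 + t) ^+ 2 / 2 * E 2%N K t
   + ((1 + t) ^+ 3 / 6 * E 3%N K t + (1 + t) ^+ 4 / 24 * E 4%N K t))).
(* 35 rounds up 1 + 4 + 16/2 + 64/6 + 256/24. The constant 29 of the statement comes from 24 * 35 =
   840 < 29^2. *)
have F0 K : F K 0 <= 35 * P.
  rewrite /F addr0 !expr1n.
  have := E0 0%N K; have := E0 1%N K; have := E0 2%N K; have := E0 3%N K.
  by have := E0 4%N K; lra.
suff g2 : (1 + y) ^+ 4 / 24 * u 4 0%N y ^+ 2 <= 35 * P.
  have -> : \sum_(j < m) c j * (1 - z j) ^+ 4 * expR (- (1 - z j) * y) = u 4 0%N y.
    by apply: eq_bigr => j _; rewrite expr0 mulr1.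
  have y1 : 0 < 1 + y by lra.
  rewrite ler_pdivlMr ?exprn_gt0//.
  have s0 : 0 <= Num.sqrt P by rewrite sqrtr_ge0.
  rewrite -(@ler_pXn2r _ 2)// ?nnegrE ?mulr_ge0 ?exprn_ge0 ?(ltW y1)//.
  have -> : (`|u 4 0%N y| * (1 + y) ^+ 2) ^+ 2 = (1 + y) ^+ 4 * u 4 0%N y ^+ 2.
    by rewrite exprMn real_normK ?num_real// mulrC -exprM.
  have -> : (29 * Num.sqrt P) ^+ 2 = 841 * P by rewrite exprMn sqr_sqrtr//; ring.
  by lra.
apply/ler_addgt0Pr => e e0.
(* The total weight at time y. The terms at n = K, each at most d, add at most W d y = e y / (1 + y)
   over [0, y], for the d chosen below. *)
pose W := 1 + (1 + y) + (1 + y) ^+ 2 / 2 + (1 + y) ^+ 3 / 6 + (1 + y) ^+ 4 / 24.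
have W0 : 0 < W.
  have h : 0 < 1 + y by lra.
  have hn n (k : R) : 0 < k -> 0 < (1 + y) ^+ n / k.
    by move=> k0; rewrite divr_gt0// exprn_gt0.
  by do 4 ?apply: addr_gt0; rewrite ?h//; apply: hn.
pose d := e / (W * (1 + y)).
have d0 : 0 < d by rewrite divr_gt0// mulr_gt0//; lra.
near \oo => K.
have dK i : (i < 5)%N -> forall t, 0 <= t -> u i K t ^+ 2 <= d.
  move: i => [|[|[|[|[|]]]]]// _; near: K; exact: u_small.
have K0 : (0 < K)%N by near: K; exact: nbhs_infty_gt.
have FK : F K y <= F K 0 + W * d * y.
  pose G t := W * d * t - F K t.
  (* The weight (1 + t)^i / i! has the previous weight as its derivative, so its [E i] cancels the
     loss - [E i] in the derivative of the preceding energy. In the derivative of [F K] only -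
     [E 5], minus the squares at n = 0 and plus the squares at n = K survive. *)
  pose dG t := W * d * 1 - (
    (u 0%N K t ^+ 2 - u 0%N 0%N t ^+ 2 - E 1%N K t) +
    (((1 + t) * (u 1%N K t ^+ 2 - u 1%N 0%N t ^+ 2 - E 2%N K t) + E 1%N K t * 1) +
    (((1 + t) ^+ 2 / 2 * (u 2%N K t ^+ 2 - u 2%N 0%N t ^+ 2 - E 3%N K t)
       + E 2%N K t * (1 + t)) +
    (((1 + t) ^+ 3 / 6 * (u 3%N K t ^+ 2 - u 3%N 0%N t ^+ 2 - E 4%N K t)
       + E 3%N K t * ((1 + t) ^+ 2 / 2)) +
    ((1 + t) ^+ 4 / 24 * (u 4%N K t ^+ 2 - u 4%N 0%N t ^+ 2 - E 5%N K t)
       + E 4%N K t * ((1 + t) ^+ 3 / 6)))))).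
  have : G 0 <= G y.
    apply: (@ge0_derive_le R G dG 0 y y0) => t /andP[t0 ty].
      have d1 : is_derive t (1 : R) (fun t => 1 + t) 1.
        by have := is_derive_funD (is_derive_cst (1 : R) t 1) (is_derive_id t (1:R)); rewrite add0r.
      have dn n : is_derive t (1 : R) (fun t => (1 + t) ^+ n.+1) (n.+1%:R * (1 + t) ^+ n).
        elim: n => [|n IHn]; first by rewrite mulr1.
        have H : is_derive t (1 : R) (fun t => (1 + t) ^+ n.+2)
           ((1 + t) * (n.+1%:R * (1 + t) ^+ n) + (1 + t) ^+ n.+1 * 1).
          rewrite (_ : (fun t => _) = (fun t => (1 + t) * (1 + t) ^+ n.+1)); last first.
            by apply/funext => s; rewrite exprS.
          exact: is_derive_funM d1 IHn.
        apply: (is_derive_eq H); rewrite exprS -[n.+2]addn1 natrD; ring.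
      have dq n (a b : R) : (n.+1%:R = a * b) -> a != 0 ->
          is_derive t (1 : R) (fun t => (1 + t) ^+ n.+1 / a) ((1 + t) ^+ n * b).
        move=> nab a0.
        have H := is_derive_funM (dn n) (is_derive_cst (a^-1 : R) t 1).
        by apply: (is_derive_eq H); rewrite mulr0 add0r nab mulrA mulKf// mulrC.
      have d2 : is_derive t (1 : R) (fun t => (1 + t) ^+ 2 / 2) (1 + t).
        by have := @dq 1%N 2 1; rewrite !mulr1; apply => //.
      have d3 : is_derive t (1 : R) (fun t => (1 + t) ^+ 3 / 6) ((1 + t) ^+ 2 / 2).
        by apply: dq => //; field.
      have d4 : is_derive t (1 : R) (fun t => (1 + t) ^+ 4 / 24) ((1 + t) ^+ 3 / 6).
        by apply: dq => //; field.
      apply: is_derive_funB; first exact: is_derive_funZ (is_derive_id _ _).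
      apply: is_derive_funD; first exact: E_derive.
      apply: is_derive_funD; first exact: is_derive_funM d1 (E_derive _ _ _).
      apply: is_derive_funD; first exact: is_derive_funM d2 (E_derive _ _ _).
      apply: is_derive_funD; first exact: is_derive_funM d3 (E_derive _ _ _).
      exact: is_derive_funM d4 (E_derive _ _ _).
    have d00 := ltW d0.
    have b i k : (i < 5)%N -> 0 < k -> (1 + t) ^+ i / k * u i K t ^+ 2 <= (1 + y) ^+ i / k * d.
      move=> i5 k0.
      have t1 : 0 <= 1 + t by lra.
      have ty1 : 1 + t <= 1 + y by lra.
      apply: ler_pM.
      - by rewrite divr_ge0 ?exprn_ge0// ltW.
      - exact: sqr_ge0.
      - rewrite ler_wpM2r ?invr_ge0 ?(ltW k0)// lerXn2r// nnegrE//.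
        exact: le_trans ty1.
      - exact: dK.
    have := @b 0%N 1 isT ltr01; have := @b 1%N 1 isT ltr01.
    have := @b 2%N 2 isT ltac:(lra); have := @b 3%N 6 isT ltac:(lra).
    have := @b 4%N 24 isT ltac:(lra).
    have p i k (w : R) : 0 < k -> 0 <= w -> 0 <= (1 + t) ^+ i / k * w.
      move=> k0 w0; rewrite mulr_ge0// divr_ge0 ?(ltW k0)// exprn_ge0//; lra.
    have := p 0%N 1 (u 0%N 0%N t ^+ 2) ltr01 (sqr_ge0 _).
    have := p 1%N 1 (u 1%N 0%N t ^+ 2) ltr01 (sqr_ge0 _).
    have := p 2%N 2 (u 2%N 0%N t ^+ 2) ltac:(lra) (sqr_ge0 _).
    have := p 3%N 6 (u 3%N 0%N t ^+ 2) ltac:(lra) (sqr_ge0 _).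
    have := p 4%N 24 (u 4%N 0%N t ^+ 2) ltac:(lra) (sqr_ge0 _).
    have := p 4%N 24 (E 5%N K t) ltac:(lra) (E_ge0 _ _ _).
    rewrite /dG /W; clear -R; clearbody u E d.
    move: (u 0%N 0%N t) (u 1%N 0%N t) (u 2%N 0%N t) (u 3%N 0%N t) (u 4%N 0%N t).
    move: (u 0%N K t) (u 1%N K t) (u 2%N K t) (u 3%N K t) (u 4%N K t).
    move: (E 1%N K t) (E 2%N K t) (E 3%N K t) (E 4%N K t) (E 5%N K t).
    clear; move=> *; lra.
  rewrite /G mulr0; lra.
have h : (1 + y) ^+ 4 / 24 * u 4 0%N y ^+ 2 <= F K y.
  have yy1 : 0 <= 1 + y by lra.
  have -> : (1 + y) ^+ 4 / 24 * u 4 0%N y ^+ 2 = 0 + (0 + (0 + (0 + (1 + y) ^+ 4 / 24 * u 4 0%N y ^+ 2))) by ring.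
  rewrite /F !lerD// ?mulr_ge0// ?divr_ge0 ?exprn_ge0//.
  apply: ler_wpM2l; first by rewrite divr_ge0 ?exprn_ge0.
  move: K0; rewrite /E; case: (K) => // k _; rewrite big_ord_recl lerDl.
  by apply: sumr_ge0 => n _; exact: sqr_ge0.
apply: (le_trans h); apply: (le_trans FK); apply: lerD => //.
have yy1 : 0 < 1 + y by lra.
have -> : W * d * y = e * (y / (1 + y)).
  by rewrite /d; field; rewrite !gt_eqF.
by apply: ler_piMr; rewrite ?(ltW e0)// ler_pdivrMr// mul1r; lra.
Unshelve. all: by end_near.
Qed.

End smoothing.

(** * The Müntz theorem for exponential sums on the half-line *)

(* The weight makes [x^(-1/p) / (1 - ln x)^2], with [y = - ln x], a function of
   [L^p(0, 1)] for every [p >= 1]. *)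
Definition exp_closure {R : realType} (mu : nat -> R) (g : R -> R) :=
  forall eps, 0 < eps -> exists m (c : nat -> R), forall y, 0 <= y ->
    `|g y - \sum_(j < m) c j * expR (- mu j * y)| <= eps / (1 + y) ^+ 2.

Section exp_closure_theory.
Context {R : realType}.
Implicit Types (mu nu : nat -> R) (g h : R -> R).

Lemma exp_closure_gen mu j : exp_closure mu (fun y => expR (- mu j * y)).
Proof.
move=> e e0; exists j.+1, (fun i => (i == j)%:R) => y y0.
rewrite big_ord_recr/= eqxx mul1r big1 => [|i _]; last by rewrite ltn_eqF ?mul0r.
by rewrite add0r subrr normr0 divr_ge0 ?ltW// exprn_gt0//; lra.
Qed.

Lemma exp_closure_lim mu g :
  (forall e, 0 < e -> exists2 h, exp_closure mu h &
    forall y, 0 <= y -> `|g y - h y| <= e / (1 + y) ^+ 2) ->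
  exp_closure mu g.
Proof.
move=> gh e e0; have e2 : 0 < e / 2 by lra.
have [h /(_ _ e2)[m [c hc]] gh2] := gh _ e2.
exists m, c => y y0; set s := \sum_(_ < _) _.
have -> : g y - s = (g y - h y) + (h y - s) by ring.
apply: le_trans (ler_normD _ _) _; apply: le_trans (lerD (gh2 _ y0) (hc _ y0)) _.
by rewrite -mulrDl -splitr.
Qed.

Lemma exp_closure_scale mu g (k : R) : exp_closure mu g ->
  exp_closure mu (fun y => k * g y).
Proof.
move=> gc e e0; have d0 : 0 < e / (`|k| + 1) by rewrite divr_gt0// ltr_wpDl.
have [m [c H]] := gc _ d0; exists m, (fun j => k * c j) => y y0.
have -> : \sum_(j < m) k * c j * expR (- mu j * y) =
          k * \sum_(j < m) c j * expR (- mu j * y).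
  by rewrite mulr_sumr; apply: eq_bigr => j _; rewrite mulrA.
rewrite -mulrBr normrM; have k1 : 0 < `|k| + 1 by rewrite ltr_wpDl.
apply: (@le_trans _ _ ((`|k| + 1) * (e / (`|k| + 1) / (1 + y) ^+ 2))).
  by apply: ler_pM => //; [lra|exact: H].
by rewrite mulrA mulrCA divff ?mulr1// gt_eqF.
Qed.

Lemma exp_sum_widen (m k : nat) (c F : nat -> R) :
  \sum_(j < m) c j * F j =
  \sum_(j < m + k) (if (j < m)%N then c j else 0) * F j.
Proof.
rewrite big_split_ord/= [X in _ + X]big1 ?addr0.
  by apply: eq_bigr => j _; rewrite ltn_ord.
by move=> j _; rewrite ltnNge leq_addr/= mul0r.
Qed.

Lemma exp_closureD mu g h : exp_closure mu g -> exp_closure mu h ->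
  exp_closure mu (fun y => g y + h y).
Proof.
move=> gc hc e e0; have e2 : 0 < e / 2 by lra.
have [m [c H]] := gc _ e2; have [k [d H']] := hc _ e2.
exists (m + k)%N, (fun j => (if (j < m)%N then c j else 0) +
  (if (j < k)%N then d j else 0)) => y y0.
under eq_bigr do rewrite mulrDl.
rewrite big_split/= -(exp_sum_widen m k c (fun j => expR (- mu j * y))) addnC.
rewrite -(exp_sum_widen k m d (fun j => expR (- mu j * y))) opprD addrACA.
apply: le_trans (ler_normD _ _) _; apply: le_trans (lerD (H _ y0) (H' _ y0)) _.
by rewrite -mulrDl -splitr.
Qed.

Lemma exp_closure_trans mu nu g :
  (forall j, exp_closure mu (fun y => expR (- nu j * y))) ->
  exp_closure nu g -> exp_closure mu g.
Proof.
move=> munu gnu; apply: exp_closure_lim => e /gnu[m [c H]].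
exists (fun y => \sum_(j < m) c j * expR (- nu j * y)) => //.
elim: m {H} => [|m IH].
  move=> d d0; exists 0%N, (fun=> 0) => y y0.
  by rewrite !big_ord0 subrr normr0 divr_ge0 ?ltW// exprn_gt0//; lra.
have := exp_closureD IH (exp_closure_scale (c m) (munu m)).
by congr exp_closure; apply/funext => y; rewrite big_ord_recr.
Qed.

Lemma prod_subr1_small (f : nat -> R) : (forall j, f j <= 1) ->
  (forall B, exists m, B <= \sum_(j < m) f j) ->
  forall e, 0 < e -> exists m, \prod_(j < m) (1 - f j) <= e.
Proof.
move=> f1 fB e e0; have [m mB] := fB (- ln e); exists m.
apply: (@le_trans _ _ (expR (- \sum_(j < m) f j))); last first.
  by rewrite -[leRHS]lnK ?posrE// ler_expR lerNl.
rewrite -sumrN expR_sum; apply: ler_prod => j _.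
by rewrite subr_ge0 f1/= expR_ge1Dx.
Qed.

(** With k the minimum of 1 and b/2, exp(b y / 2) >= 1 + b y / 2 >= k (1 + y); square and invert. *)
Lemma expRN_sqr_bound (b y : R) : 0 < b -> 0 <= y ->
  expR (- b * y) <= (Num.min 1 (b / 2)) ^- 2 / (1 + y) ^+ 2.
Proof.
move=> b0 y0; set k := Num.min _ _.
have k0 : 0 < k by rewrite lt_min ltr01/= divr_gt0.
have k1 : k <= 1 by rewrite ge_min lexx.
have kb : k <= b / 2 by rewrite ge_min lexx orbT.
have yk : k * (1 + y) <= expR (b / 2 * y).
  apply: le_trans (expR_ge1Dx _); rewrite mulrDr mulr1 lerD// ler_wpM2r//.
have -> : - b * y = - (b / 2 * y) + - (b / 2 * y) by field.
have y1 : 0 < 1 + y by lra.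
rewrite expRD expRN -invfM -invfM lef_pV2 ?posrE ?mulr_gt0 ?exprn_gt0 ?expR_gt0//.
by rewrite -exprMn -expr2 ler_sqr ?nnegrE ?expR_ge0// mulr_ge0 ?(ltW k0) ?(ltW y1).
Qed.

(** 3 r <= 4 M makes [golitschek_factor] available for every exponent >= M. If r is itself an
    exponent nothing is to be done; otherwise prepending it keeps the sequence injective, which the
    divided differences require. *)
Lemma exp_closure_large mu (M r : R) : injective mu -> 0 < r -> 3 * r <= 4 * M ->
  (forall B, exists m, B <= \sum_(j < m) (if M <= mu j then (mu j)^-1 else 0)) ->
  exp_closure mu (fun y => expR (- r * y)).
Proof.
move=> muI r0 rM muB.
have [[j <-]|rmu] := pselect (exists j, mu j = r); first exact: exp_closure_gen.
pose nu j := if j is i.+1 then mu i else r.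
have nuI : injective nu.
  move=> [|i] [|j]//=; first by move=> e; case: rmu; exists j.
    by move=> e; case: rmu; exists i.
  by move=> /muI ->.
pose f j := if M <= mu j then r / (4 * mu j) else 0.
have f1 j : f j <= 1.
  rewrite /f; case: ifPn => // Mmu; rewrite ler_pdivrMr ?mul1r; lra.
have fB B : exists m, B <= \sum_(j < m) f j.
  have [m mB] := muB (4 / r * B); exists m.
  have -> : \sum_(j < m) f j = r / 4 *
      \sum_(j < m) (if M <= mu j then (mu j)^-1 else 0).
    rewrite mulr_sumr; apply: eq_bigr => j _; rewrite /f; case: ifPn => // Mmu.
      by field; rewrite gt_eqF//; lra.
    by rewrite mulr0.
  have := ler_wpM2l (ltW (divr_gt0 r0 (ltr0n R 4))) mB.
  by apply: le_trans; rewrite le_eqVlt; apply/orP; left; apply/eqP; field; rewrite gt_eqF.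
move=> e e0.
set K := (Num.min 1 (r / 4 / 2)) ^- 2.
have K0 : 0 < K.
  by rewrite invr_gt0 exprn_gt0// lt_min ltr01/=; lra.
have [m mP] := prod_subr1_small f1 fB (divr_gt0 e0 K0).
have [c [c0 H]] := golitschek_approx nuI r0 rM m.
exists m, (fun j => - c j.+1) => y y0.
have := H y y0; rewrite big_ord_recl/= c0 mul1r.
have -> : \sum_(j < m) - c j.+1 * expR (- mu j * y) =
         - \sum_(j < m) c (bump 0 j) * expR (- nu (bump 0 j) * y).
  by rewrite -sumrN; apply: eq_bigr => j _; rewrite mulNr.
rewrite opprK => /le_trans; apply.
have yb := @expRN_sqr_bound (r / 4) y ltac:(lra) y0.
apply: (@le_trans _ _ (e / K * (K / (1 + y) ^+ 2))).
  apply: ler_pM => //; rewrite ?expR_ge0//.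
  by apply: prodr_ge0 => j _; rewrite subr_ge0; exact: f1.
by rewrite mulrA divfK// gt_eqF.
Qed.

Lemma exp_closure_small mu (r : R) : injective mu -> 0 < r <= 1 ->
  (forall B, exists m, B <= \sum_(j < m) (if 0 < mu j < 1 then mu j else 0)) ->
  exp_closure mu (fun y => expR (- r * y)).
Proof.
move=> muI /andP[r0 r1] muB.
have [[j <-]|rmu] := pselect (exists j, mu j = r); first exact: exp_closure_gen.
pose z j := if j is i.+1 then 1 - mu i else 1 - r.
have zI : injective z.
  move=> [|i] [|j]//= /addrI/oppr_inj; first by move=> e; case: rmu; exists j.
    by move=> e; case: rmu; exists i.
  by move=> /muI ->.
have z0 : 0 <= z 0%N < 1 by rewrite /z; apply/andP; split; lra.
have /andP[z00 z01] := z0.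
have d0 : 0 < 1 - z 0%N ^+ 2 by rewrite subr_gt0 expr_lt1.
have d1 : 1 - z 0%N ^+ 2 <= 1 by rewrite gerBl sqr_ge0.
pose f j := if 0 < z j.+1 < 1 then (1 - z 0%N ^+ 2) * (1 - z j.+1) else 0.
have f1 j : f j <= 1.
  rewrite /f; case: ifPn => // /andP[h1 h2].
  by apply: mulr_ile1; rewrite ?(ltW d0)//; lra.
have fB B : exists m, B <= \sum_(j < m) f j.
  have [m mB] := muB (B / (1 - z 0%N ^+ 2)); exists m.
  move: mB; rewrite ler_pdivrMr// => /le_trans; apply.
  rewrite mulr_suml; apply: ler_sum => j _; rewrite /f /=.
  have -> : (0 < 1 - mu j < 1) = (0 < mu j < 1).
    by rewrite subr_gt0 gtrBl andbC.
  by case: ifPn => _; rewrite ?mul0r// mulrC subKr.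
move=> e e0.
(* Smoothing turns an ℓ^2 bound s into 29 s and the coefficient 1 of the target into r^4; after
   division by r^4 exactly e remains. *)
pose s := e * r ^+ 4 / 29.
have s0 : 0 < s by rewrite divr_gt0// mulr_gt0// exprn_gt0.
have sd0 : 0 < s ^+ 2 * (1 - z 0%N ^+ 2) by rewrite mulr_gt0// exprn_gt0.
have [m mP] := prod_subr1_small f1 fB sd0.
have [c [c0 supp H]] := blaschke_approx zI z0 m.
pose P := s ^+ 2.
have HP K : \sum_(k < K) (\sum_(j < m.+1) c j * z j ^+ k) ^+ 2 <= P.
  by apply: (le_trans (H K)); rewrite ler_pdivrMr.
exists m, (fun j => - (c j.+1 * mu j ^+ 4 / r ^+ 4)) => y y0.
have := heat_smoothing supp HP y0; rewrite big_ord_recl/= c0 mul1r subKr.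
set S := \sum_(i < m) _ => hS.
have -> : \sum_(j < m) - (c j.+1 * mu j ^+ 4 / r ^+ 4) * expR (- mu j * y) =
         - (S / r ^+ 4).
  rewrite mulr_suml -sumrN; apply: eq_bigr => j _; rewrite /bump /= add1n subKr.
  by rewrite add0n [LHS]mulNr; congr (- _); rewrite mulrAC.
have -> : expR (- r * y) - - (S / r ^+ 4) = (r ^+ 4 * expR (- r * y) + S) / r ^+ 4.
  by field; rewrite gt_eqF.
rewrite normrM [X in _ * X]ger0_norm ?invr_ge0 ?exprn_ge0 ?(ltW r0)//.
rewrite ler_pdivrMr ?exprn_gt0//; apply: (le_trans hS).
rewrite /P sqrtr_sqr ger0_norm ?(ltW s0)// /s le_eqVlt; apply/orP; left; apply/eqP.
by field; rewrite gt_eqF//; lra.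
Qed.

(* Exponents in a short interval below [M] have divergent reciprocal sum, so they
   generate all exponents up to [6/5 M]. *)
Lemma exp_closure_grow mu : (forall r, 0 < r <= 1 -> exp_closure mu (fun y => expR (- r * y))) ->
  forall r, 0 < r -> exp_closure mu (fun y => expR (- r * y)).
Proof.
move=> mu1.
suff H n : forall r : R, 0 < r <= 1 + n%:R / 5 -> exp_closure mu (fun y => expR (- r * y)).
  move=> r r0; have [n rn] : exists n : nat, 5 * r <= n%:R.
    exists (Num.truncn (5 * r)).+1; apply: ltW; apply: truncnS_gt.
  by apply: (H n); rewrite r0/=; lra.
elim: n => [|n IH] r; first by rewrite mul0r addr0; exact: mu1.
move=> /andP[r0 rn].
set M := 1 + n%:R / 5 in IH *.
have M1 : 1 <= M by rewrite lerDl divr_ge0.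
have rM : 5 * r <= 6 * M.
  by move: rn M1; rewrite -natr1 /M; lra.
(* The shift by 10 keeps all exponents in [9/10 M, M]. Then 3 * (6/5) = 4 * (9/10) is precisely the
   condition of [exp_closure_large], and r <= M + 1/5 <= 6/5 M because M >= 1. *)
pose nu j : R := M * (1 - (j%:R + 10)^-1).
have j10 j : 0 < (j%:R + 10 : R)^-1 <= 10^-1.
  have h : 0 <= j%:R :> R by [].
  apply/andP; split; first by rewrite invr_gt0; lra.
  by rewrite lef_pV2 ?posrE; lra.
have nub j : 9 / 10 * M <= nu j <= M.
  have /andP[h1 h2] := j10 j; rewrite /nu; apply/andP; split.
    by rewrite [leLHS]mulrC ler_wpM2l; lra.
  by rewrite ler_piMr; lra.
apply: (@exp_closure_trans mu nu).
  move=> j; apply: IH; have /andP[h1 h2] := nub j; rewrite h2 andbT; lra.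
apply: (@exp_closure_large nu (9 / 10 * M)) => //.
- move=> i j /mulfI; rewrite gt_eqF; last lra.
  by move=> /(_ isT)/addrI/oppr_inj/invr_inj/addIr/(mulrIn (oner_neq0 R)).
- lra.
- move=> B; exists (Num.truncn (M * B)).+1.
  apply: (@le_trans _ _ (\sum_(j < (Num.truncn (M * B)).+1) M^-1)).
    rewrite sumr_const card_ord -[_ *+ _]mulr_natl -ler_pdivrMr ?invr_gt0; last lra.
    by rewrite invrK mulrC ltW// truncnS_gt.
  apply: ler_sum => j _; have /andP[h1 h2] := nub j; rewrite h1.
  by rewrite lef_pV2 ?posrE; lra.
Qed.

(** μ / (μ^2 + 1) is at most 1/μ for μ >= 1 and at most μ for μ < 1, so if the sum of the
    reciprocals is bounded the sum of the small exponents diverges. Restricting to r <= 1 allows the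
    threshold M = 1. *)
Lemma muntz_exp mu : injective mu -> (forall j, 0 < mu j) ->
  (forall B, exists m, B <= \sum_(j < m) mu j / (mu j ^+ 2 + 1)) ->
  forall r, 0 < r -> exp_closure mu (fun y => expR (- r * y)).
Proof.
move=> muI mu0 muB; apply: exp_closure_grow => r /andP[r0 r1].
have [hA|hA] := pselect (forall B, exists m,
    B <= \sum_(j < m) (if 1 <= mu j then (mu j)^-1 else 0)).
  by apply: (@exp_closure_large mu 1) => //; lra.
apply: exp_closure_small; rewrite ?r0// => B.
move/existsNP: hA => [B1 hB1].
have [m mB] := muB (B + B1); exists m.
have {}hB1 : \sum_(j < m) (if 1 <= mu j then (mu j)^-1 else 0) <= B1.
  by rewrite leNgt; apply/negP => h; apply: hB1; exists m; exact: ltW.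
rewrite -(lerD2r B1); apply: (le_trans mB).
apply: le_trans (lerD (lexx _) hB1).
rewrite -big_split/=; apply: ler_sum => j _; rewrite mu0/= [1 <= _]leNgt.
have m0 := mu0 j.
have p : 0 < mu j ^+ 2 + 1 by rewrite ltr_wpDl// sqr_ge0.
case: (ltP (mu j) 1) => h /=.
  rewrite addr0 ler_pdivrMr// ler_peMr ?(ltW m0)//.
  by have := sqr_ge0 (mu j); lra.
rewrite add0r ler_pdivrMr// mulrDr mulr1 expr2 mulrA mulVf ?gt_eqF// mul1r.
by rewrite lerDl invr_ge0 ltW.
Qed.

End exp_closure_theory.

(** * The L^p norm on the unit interval *)

Section integral_restriction.
Context {R : realType}.
Local Notation mu := (@lebesgue_measure R).
Import HBNNSimple.

Lemma sintegral_muI_proj (h : {nnsfun measurableTypeR R >-> R}) :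
  sintegral mu (proj_nnsfun h (measurable_itv `[0%R, 1%R])) =
  sintegral (muI R) h.
Proof.
apply: eq_fsbigr => x _; have [->|x0] := eqVneq x 0; first by rewrite !mul0e.
congr (_ * _)%E; rewrite /muI /= /mrestr; congr (mu _).
apply/seteqP; split => y /=; rewrite mindicE.
  case: (boolP (y \in _)) => [/set_mem yI|_]; first by rewrite mulr1 => <-.
  by rewrite mulr0 => e; rewrite e eqxx in x0.
by move=> [<- yI]; rewrite mem_set// mulr1.
Qed.

(** [Lnorm] integrates over the whole line against [muI], whereas the estimates use Lebesgue measure
    on [I01]. Here g is an arbitrary nonnegative function, so the two suprema over simple functions
    are compared directly, by projecting these onto [I01]. *)
Lemma integral_muI (g : R -> \bar R) : (forall x, 0 <= g x)%E ->
  (\int[muI R]_x g x = \int[mu]_(x in I01) g x)%E.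
Proof.
move=> g0; rewrite ge0_integralTE// ge0_integralE//.
apply/eqP; rewrite eq_le; apply/andP; split; apply: ge_ereal_sup => _ [h /= hg <-].
  rewrite -sintegral_muI_proj; apply: ereal_sup_ubound.
  exists (proj_nnsfun h (measurable_itv `[0%R, 1%R])) => //= x.
  rewrite /patch mindicE; case: ifPn => _; first by rewrite mulr1.
  by rewrite mulr0.
apply: ereal_sup_ubound; exists h => /=.
  by move=> x; apply: (le_trans (hg x)); rewrite /patch; case: ifPn.
rewrite -sintegral_muI_proj; congr sintegral; apply/funext => x /=.
rewrite mindicE; case: (boolP (x \in _)) => xI; first by rewrite mulr1.
rewrite mulr0; apply/eqP; rewrite eq_le; apply/andP; split => //.
by have := hg x; rewrite /patch (negbTE xI) lee_fin.
Qed.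

End integral_restriction.

Instance lebesgue_ae_filter (R : realType) :
  Filter (nbhs (almost_everywhere (@lebesgue_measure R))).
Proof. exact: ae_filter_ringOfSetsType. Qed.

Section LpNorm_theory.
Context {R : realType}.
Local Notation mu := (@lebesgue_measure R).
Implicit Types (p k : R) (f g : R -> R).

Lemma measurable_I01 : measurable (I01 : set R).
Proof. exact: measurable_itv. Qed.
Hint Resolve measurable_I01 : core.

Lemma measurable_normr_powR p f (D : set R) : measurable_fun D f ->
  measurable_fun D (fun x => (`|f x| `^ p)%:E).
Proof.
move=> mf; apply/measurable_EFinP.
by apply: (measurableT_comp (measurable_powR p)); exact: measurableT_comp.
Qed.

Lemma LpNormE p f :
  LpNorm p f = ((\int[mu]_(x in I01) (`|f x| `^ p)%:E) `^ p^-1)%E.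
Proof.
rewrite /LpNorm unlock integral_muI => [|x]; last exact: poweR_ge0.
by congr (_ `^ _)%E; apply: eq_integral => x _; rewrite /= poweR_EFin.
Qed.

Lemma eq_LpNorm p f g : (forall x, I01 x -> f x = g x) ->
  LpNorm p f = LpNorm p g.
Proof.
move=> fg; rewrite (LpNormE p f) (LpNormE p g).
have -> // : (\int[mu]_(x in I01) (`|f x| `^ p)%:E =
              \int[mu]_(x in I01) (`|g x| `^ p)%:E)%E.
by apply: eq_integral => x /set_mem/fg ->.
Qed.

Lemma LpNorm_ge0 p f : (0 <= LpNorm p f)%E.
Proof. exact: Lnorm_ge0. Qed.

Lemma LpNorm_poweR p f : 0 < p ->
  (LpNorm p f `^ p = \int[mu]_(x in I01) (`|f x| `^ p)%:E)%E.
Proof.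
move=> p0; rewrite LpNormE -poweRrM mulVf ?gt_eqF// poweRe1//.
by apply: integral_ge0 => x _; rewrite lee_fin powR_ge0.
Qed.

Lemma LpNorm_le_integral p f (A : R) : 0 < p -> 0 <= A ->
  (\int[mu]_(x in I01) (`|f x| `^ p)%:E <= (A `^ p)%:E)%E ->
  (LpNorm p f <= A%:E)%E.
Proof.
move=> p0 A0 fA; rewrite LpNormE.
have -> : A%:E = ((A `^ p)%:E `^ p^-1)%E.
  by rewrite poweR_EFin -powRrM divff ?gt_eqF// powRr1.
apply: gt0_ler_poweR; last exact: fA; rewrite ?invr_ge0 ?(ltW p0)// in_itv/= leey andbT.
  by apply: integral_ge0 => x _; rewrite lee_fin powR_ge0.
by rewrite lee_fin powR_ge0.
Qed.

Lemma ae_le_LpNorm p f g : 0 < p ->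
  measurable_fun I01 f -> measurable_fun I01 g ->
  {ae mu, forall x, I01 x -> `|f x| <= `|g x|} ->
  (LpNorm p f <= LpNorm p g)%E.
Proof.
move=> p0 mf mg fg; rewrite !LpNormE.
have i0 h : (0 <= \int[mu]_(x in I01) (`|h x| `^ p)%:E)%E.
  by apply: integral_ge0 => x _; rewrite lee_fin powR_ge0.
apply: gt0_ler_poweR; [by rewrite invr_ge0 ltW|by rewrite in_itv/= leey i0 ..|].
apply: ae_ge0_le_integral.
- exact: measurable_I01.
- by move=> x _; rewrite lee_fin powR_ge0.
- exact: measurable_normr_powR.
- by move=> x _; rewrite lee_fin powR_ge0.
- exact: measurable_normr_powR.
move: fg; apply: filterS => x fgx /fgx h.
by rewrite lee_fin ge0_ler_powR ?nnegrE// ltW.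
Qed.

Lemma le_LpNorm p f g : 0 < p ->
  measurable_fun I01 f -> measurable_fun I01 g ->
  (forall x, I01 x -> `|f x| <= `|g x|) -> (LpNorm p f <= LpNorm p g)%E.
Proof. by move=> p0 mf mg fg; apply: ae_le_LpNorm => //; exact: nearW. Qed.

Lemma LpNormD p f g : 1 <= p ->
  measurable_fun I01 f -> measurable_fun I01 g ->
  (LpNorm p (fun x => (f x + g x)%R) <= LpNorm p f + LpNorm p g)%E.
Proof.
move=> p1 mf mg.
(* Minkowski's inequality is applied on the whole line, so functions measurable only on [I01] are
   extended by 0. *)
have patchE h : LpNorm p h = LpNorm p (h \_ I01).
  by apply: eq_LpNorm => x xI; rewrite /patch mem_set.
rewrite patchE (patchE f) (patchE g).
have -> : (fun x => f x + g x) \_ I01 = (f \_ I01 \+ g \_ I01).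
  apply/funext => x; rewrite /patch /=; case: ifPn => // _.
  by rewrite addr0.
by apply: minkowski_EFin => //; apply/(measurable_restrictT _ _).1.
Qed.

Lemma LpNormZ p k f : 0 < p -> measurable_fun I01 f ->
  LpNorm p (fun x => (k * f x)%R) = (`|k|%:E * LpNorm p f)%E.
Proof.
move=> p0 mf; rewrite !LpNormE.
have -> : (\int[mu]_(x in I01) (`|k * f x| `^ p)%:E =
    (`|k| `^ p)%:E * \int[mu]_(x in I01) (`|f x| `^ p)%:E)%E.
  rewrite -ge0_integralZl_EFin.
  - by apply: eq_integral => x _; rewrite normrM powRM// EFinM.
  - exact: measurable_I01.
  - by move=> x _; rewrite lee_fin powR_ge0.
  - exact: measurable_normr_powR.
  - exact: powR_ge0.
rewrite poweRM ?lee_fin ?powR_ge0//; last first.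
  by apply: integral_ge0 => x _; rewrite lee_fin powR_ge0.
by rewrite poweR_EFin -powRrM divff ?gt_eqF// powRr1.
Qed.

Lemma LpNorm0 p : 0 < p -> LpNorm p (fun=> 0) = 0%E.
Proof. by move=> p0; apply: Lnorm0; rewrite eqe gt_eqF. Qed.

Lemma measurable_sumF (D : set R) m (F : nat -> R -> R) :
  (forall j, (j < m)%N -> measurable_fun D (F j)) ->
  measurable_fun D (fun x => \sum_(j < m) F j x).
Proof.
elim: m => [|m IH] mF.
  by under eq_fun do rewrite big_ord0; exact: measurable_cst.
under eq_fun do rewrite big_ord_recr/=.
by apply: measurable_funD; [apply: IH => j jm; apply: mF; exact: ltnW|exact: mF].
Qed.

Lemma LpNorm_sum p m (F : nat -> R -> R) : 1 <= p ->
  (forall j, (j < m)%N -> measurable_fun I01 (F j)) ->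
  (LpNorm p (fun x => (\sum_(j < m) F j x)%R) <= \sum_(j < m) LpNorm p (F j))%E.
Proof.
move=> p1; have p0 : 0 < p by lra.
elim: m => [|m IH] mF.
  by under eq_fun do rewrite big_ord0; rewrite big_ord0 LpNorm0.
under eq_fun do rewrite big_ord_recr/=.
have mF' j : (j < m)%N -> measurable_fun I01 (F j) by move=> jm; apply: mF; exact: ltnW.
rewrite big_ord_recr/=; apply: le_trans (LpNormD p1 _ _) _.
- exact: measurable_sumF.
- exact: mF.
- by apply: leeD => //; exact: IH.
Qed.

End LpNorm_theory.
#[global] Hint Resolve measurable_I01 : core.

(** * Integrals with a singularity at 0 *)

Section integral_primitive.
Context {R : realType}.
Local Notation mu := (@lebesgue_measure R).

(** Since f may blow up at 0, the fundamental theorem is applied on [c / (n + 1), c] and n tends to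
    infinity by monotone convergence; F >= 0 lets the value at the lower endpoint be dropped. For n
    = 0 the interval is a point. *)
Lemma integral_primitive_le (f F : R -> R) (c : R) : 0 < c ->
  (forall x, 0 < x <= c -> is_derive x 1 F (f x)) ->
  (forall x, 0 < x <= c -> {for x, continuous f}) ->
  (forall x, 0 < x <= c -> 0 <= f x) ->
  (forall x, 0 < x <= c -> 0 <= F x) ->
  (\int[mu]_(x in `[0%R, c]) (f x)%:E <= (F c)%:E)%E.
Proof.
move=> c0 dF cf f0 F0.
have mf0 : measurable_fun `]0, c]%classic f.
  apply: subspace_continuous_measurable_fun; first exact: measurable_itv.
  apply: continuous_in_subspaceT => x /set_mem/=; rewrite in_itv/=; exact: cf.
rewrite -integral_itv_obnd_cbnd; last exact/measurable_EFinP.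
pose I n : set R := `[c / n.+1%:R, c]%classic.
have n0 n : 0 < (n.+1%:R : R) by [].
have Ic n x : I n x -> 0 < x <= c.
  rewrite /I/= in_itv/= => /andP[h ->]; rewrite andbT.
  by apply: lt_le_trans h; rewrite divr_gt0.
have IU : `]0, c]%classic = \bigcup_n I n.
  apply/seteqP; split => x /=.
    rewrite in_itv/= => /andP[x0 xc].
    exists (Num.truncn (c / x)) => //; rewrite /I/= in_itv/= xc andbT.
    by rewrite ler_pdivrMr// mulrC -ler_pdivrMr// ltW// truncnS_gt.
  by move=> [n _ /Ic]; rewrite in_itv/= .
have cI n : {within I n, continuous f}.
  apply: continuous_in_subspaceT => x /set_mem/Ic; exact: cf.
rewrite IU.
have mf n : measurable_fun (I n) (fun x => (f x)%:E).
  apply/measurable_EFinP; apply: subspace_continuous_measurable_fun => //.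
  exact: measurable_itv.
have ndI : nondecreasing_seq I.
  apply/nondecreasing_seqP => n; rewrite subsetEset => x; rewrite /I /= !in_itv/=.
  move=> /andP[h ->]; rewrite andbT; apply: le_trans h.
  by rewrite ler_pM2l// lef_pV2 ?posrE// ler_nat.
have If0 n x : I n x -> (0 <= (f x)%:E)%E by move=> Ix; rewrite lee_fin; exact: f0 x (Ic _ _ Ix).
have mI n : measurable (I n) by exact: measurable_itv.
have lim : (\int[mu]_(x in I n) (f x)%:E @[n --> \oo] -->
    \int[mu]_(x in \bigcup_n I n) (f x)%:E)%E.
  exact: ge0_nondecreasing_set_cvg_integral.
move/cvg_lim : (lim) => <- //; apply: lime_le; first by apply/cvg_ex; eexists; exact: lim.
apply: nearW => n.
have [->|nn0] := eqVneq n 0%N.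
  rewrite /I divr1 set_itv1 integral_set1 lee_fin F0// c0/=; exact: lexx.
have ccn : c / n.+1%:R < c by rewrite ltr_pdivrMr// ltr_pMr// ltr1n ltnS lt0n.
have Iin x : x \in `[c / n.+1%:R, c] -> 0 < x <= c by move=> h; exact: (@Ic n).
rewrite (@continuous_FTC2 _ f F) => //.
- rewrite -EFinB lee_fin gerBl F0// divr_gt0//= ltW//.
- exact: cI n.
- have cF x : 0 < x <= c -> {for x, continuous F}.
    move=> xc; apply: differentiable_continuous; apply/derivable1_diffP.
    by have [] := dF x xc.
  split.
  + move=> x; rewrite in_itv/= => /andP[h1 h2].
    by have [] := dF x (Iin x _); rewrite // in_itv/= !ltW.
  + by apply: cvg_at_right_filter; apply: cF; rewrite divr_gt0//= ltW.
  + by apply: cvg_at_left_filter; apply: cF; rewrite c0/=.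
- move=> x; rewrite in_itv/= => /andP[h1 h2].
  have xc : 0 < x <= c by apply: Iin; rewrite in_itv/= !ltW.
  by rewrite derive1E; have [_ ->] := dF x xc.
Qed.

End integral_primitive.

Lemma is_derive_funV {R : realType} (f : R -> R) (t df : R) : f t != 0 ->
  is_derive t 1 f df -> is_derive t 1 (fun u => (f u)^-1) (- f t ^- 2 * df).
Proof. by move=> f0 h; exact: is_deriveV. Qed.

Section Lp_power.
Context {R : realType}.
Local Notation mu := (@lebesgue_measure R).
Implicit Types (p q b c : R).

Lemma integral_powR_le b c : -1 < b -> 0 < c ->
  (\int[mu]_(x in `[0%R, c]) (x `^ b)%:E <= (c `^ (b + 1) / (b + 1))%:E)%E.
Proof.
move=> b1 c0; have b10 : 0 < b + 1 by lra.
apply: (@integral_primitive_le R (fun x => x `^ b) (fun x => x `^ (b + 1) / (b + 1))) => //.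
- move=> x /andP[x0 _].
  have H := is_derive_funM (is_derive1_powR (b + 1) x0)
    (is_derive_cst ((b + 1)^-1 : R) x 1).
  apply: (is_derive_eq H); rewrite mulr0 add0r addrK mulrA mulVf ?mul1r//.
  by rewrite gt_eqF.
- move=> x /andP[x0 _]; apply: differentiable_continuous; apply/derivable1_diffP.
  by apply: derivable_powR; rewrite in_itv/= x0.
- by move=> x _; exact: powR_ge0.
- by move=> x _; rewrite divr_ge0 ?powR_ge0// ltW.
Qed.

(** A primitive is 1 / (1 - ln x), equal to 1 at x = 1; with y = - ln x this is the integral of (1 +
    y)^(-2). *)
Lemma integral_log_le :
  (\int[mu]_(x in I01) (x^-1 / (1 - ln x) ^+ 2)%:E <= 1)%E.
Proof.
have l1 (x : R) : 0 < x <= 1 -> 0 < 1 - ln x.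
  by move=> /andP[x0 x1]; have := ln_le0 x1; lra.
have dl (x : R) : 0 < x -> is_derive x (1 : R) (fun x : R => 1 - ln x) (- x^-1).
  move=> x0; have H := is_derive_funB (is_derive_cst (1 : R) x 1) (is_derive1_ln x0).
  by apply: (is_derive_eq H); rewrite sub0r.
have dF (x : R) : 0 < x <= 1 -> is_derive x (1 : R) (fun x : R => (1 - ln x)^-1) (x^-1 / (1 - ln x) ^+ 2).
  move=> x01; have /andP[x0 _] := x01; have h := l1 _ x01.
  have H := @is_derive_funV _ (fun x => 1 - ln x) x _ (lt0r_neq0 h) (dl x x0).
  by apply: (is_derive_eq H); rewrite mulrNN mulrC.
have := @integral_primitive_le R (fun x => x^-1 / (1 - ln x) ^+ 2)
   (fun x => (1 - ln x)^-1) 1 ltr01.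
rewrite ln1 subr0 invr1; apply => //.
- move=> x x01; have /andP[x0 _] := x01; have h := l1 _ x01.
  apply: differentiable_continuous; apply/derivable1_diffP.
  have h2 : (fun x : R => (1 - ln x) * (1 - ln x)) x != 0.
    by rewrite mulf_neq0// gt_eqF.
  have H3 := @is_derive_funV _ (fun x => (1 - ln x) * (1 - ln x)) x _ h2 (is_derive_funM (dl x x0) (dl x x0)).
  have H1 := @is_derive_funV _ id x 1 (lt0r_neq0 x0) (is_derive_id x 1).
  by have [] := is_derive_funM H1 H3.
- by move=> x /[dup] /l1 h /andP[x0 _]; rewrite divr_ge0 ?invr_ge0 ?ltW// exprn_gt0.
- by move=> x /l1 h; rewrite invr_ge0 ltW.
Qed.

Lemma ae_neq (a : R) : {ae mu, forall x, x != a}.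
Proof.
exists [set a]; split; [exact: measurable_set1|exact: lebesgue_measure_set1|].
by move=> x /= /negP; rewrite negbK => /eqP.
Qed.

Lemma measurable_powR_id q (D : set R) : measurable_fun D (fun x : R => x `^ q).
Proof. exact: measurable_funTS (measurable_powR q). Qed.

(* [0 < x] because [x = 0] carries the junk values [0 `^ q], [ln 0] and [0^-1]. *)
Lemma LpNorm_le_dominated p (f g : R -> R) (A : R) : 0 < p -> 0 <= A ->
  measurable_fun I01 f -> measurable_fun I01 g ->
  (forall x, I01 x -> 0 <= g x) ->
  (forall x, 0 < x <= 1 -> `|f x| `^ p <= g x) ->
  (\int[mu]_(x in I01) (g x)%:E <= (A `^ p)%:E)%E ->
  (LpNorm p f <= A%:E)%E.
Proof.
move=> p0 A0 mf mg g0 fg gA; apply: LpNorm_le_integral => //.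
apply: le_trans gA; apply: ae_ge0_le_integral.
- exact: measurable_I01.
- by move=> x _; rewrite lee_fin powR_ge0.
- exact: measurable_normr_powR.
- by move=> x xI; rewrite lee_fin; exact: g0.
- exact/measurable_EFinP.
apply: filterS (ae_neq 0) => x x0; rewrite /I01/= in_itv/= => /andP[x0' x1].
by rewrite lee_fin fg// lt_neqAle eq_sym x0 x0'.
Qed.

Lemma LpNorm_powR_le p q : 0 < p -> - p^-1 < q ->
  (LpNorm p (fun x => (x `^ q)%R) <= ((p * q + 1)^-1 `^ p^-1)%:E)%E.
Proof.
move=> p0 pq; have pq1 : 0 < p * q + 1.
  by move: pq; rewrite -(ltr_pM2l p0) mulrN divff ?gt_eqF//; lra.
apply: (@LpNorm_le_dominated _ _ (fun x => x `^ (p * q))) => //.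
- exact: powR_ge0.
- exact: measurable_powR_id.
- exact: measurable_powR_id.
- by move=> x _; exact: powR_ge0.
- by move=> x /andP[x0 _]; rewrite ger0_norm ?powR_ge0// -powRrM mulrC.
- rewrite -powRrM mulVf ?gt_eqF// powRr1 ?invr_ge0 ?(ltW pq1)//.
  have -> : (p * q + 1)^-1 = 1 `^ (p * q + 1) / (p * q + 1) by rewrite powR1 mul1r.
  by apply: integral_powR_le => //; lra.
Qed.

Lemma LpNorm_exp_closure p (lam : nat -> R) (f g : R -> R) : 1 <= p ->
  measurable_fun I01 f ->
  (forall x, 0 < x <= 1 -> g (- ln x) = x `^ p^-1 * f x) ->
  exp_closure (fun j => lam j + p^-1) g ->
  forall e, 0 < e -> exists m (c : nat -> R),
    (LpNorm p (fun x => (f x - \sum_(j < m) c j * x `^ lam j)%R) <= e%:E)%E.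
Proof.
move=> p1 mf0 gf H e e0; have p0 : 0 < p by lra.
have [m [c Hc]] := H e e0; exists m, c.
have mf : measurable_fun I01 (fun x => f x - \sum_(j < m) c j * x `^ lam j).
  apply: measurable_funB => //.
  apply: (measurable_sumF (F := fun j x => c j * x `^ lam j)) => j _.
  by apply: measurable_funM => //; exact: measurable_powR_id.
have mg : measurable_fun I01 (fun x : R => x^-1 / (1 - ln x) ^+ 2).
  apply: (@eq_measurable_fun _ _ _ _ _
    (fun x : R => x `^ (-1) * ((1 - ln x) ^+ 2) `^ (-1))).
    move=> x /set_mem; rewrite /I01/= in_itv/= => /andP[x0 _].
    by rewrite !powR_inv1// sqr_ge0.
  apply: measurable_funM; first exact: measurable_powR_id.
  apply: (measurableT_comp (measurable_powR (-1))); apply: measurable_funX.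
  apply: measurable_funB; first exact: measurable_cst.
  by apply: measurable_funTS; exact: measurable_ln.
apply: (@LpNorm_le_dominated p _ (fun x => e `^ p * (x^-1 / (1 - ln x) ^+ 2))) => //.
- exact: ltW.
- exact: measurable_funM.
- move=> x; rewrite /I01/= in_itv/= => /andP[x0 x1].
  by rewrite mulr_ge0 ?powR_ge0// divr_ge0 ?invr_ge0// sqr_ge0.
- move=> x /andP[x0 x1].
  have y0 : 0 <= - ln x by have := ln_le0 x1; lra.
  have := Hc _ y0.
  have ex (r : R) : expR (- (r + p^-1) * - ln x) = x `^ p^-1 * x `^ r.
    by rewrite /powR gt_eqF// -expRD; congr expR; ring.
  rewrite gf ?x0//; under eq_bigr do rewrite ex mulrCA.
  rewrite -mulr_sumr -mulrBr normrM ger0_norm ?powR_ge0//.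
  set F := `|_ - _| => hF.
  have xp0 : 0 < x `^ p^-1 by exact: powR_gt0.
  have l1 : 1 <= 1 - ln x by lra.
  have l0 : 0 < 1 - ln x by lra.
  have FF : F <= e / (1 - ln x) ^+ 2 * (x `^ p^-1)^-1.
    by rewrite ler_pdivlMr// mulrC.
  have := @ge0_ler_powR R p (ltW p0) F (e / (1 - ln x) ^+ 2 * (x `^ p^-1)^-1).
  rewrite !nnegrE normr_ge0 => /(_ isT) h.
  apply: (le_trans (h _ FF)).
    by rewrite mulr_ge0 ?invr_ge0 ?(ltW xp0)// divr_ge0 ?(ltW e0)// sqr_ge0.
  rewrite powRM; last 2 first.
    by rewrite divr_ge0 ?(ltW e0)// sqr_ge0.
    by rewrite invr_ge0 ltW.
  rewrite -powRN -powRrM mulNr mulVf ?gt_eqF// powR_inv1 ?(ltW x0)//.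
  rewrite powRM ?invr_ge0 ?sqr_ge0 ?(ltW e0)//.
  rewrite -!mulrA ler_wpM2l ?powR_ge0// mulrC ler_wpM2l ?invr_ge0 ?(ltW x0)//.
  (* As (1 - ln x)^(-2) <= 1 and p >= 1, its p-th power is no larger, so the single integral of
     [integral_log_le] serves for every p. *)
  by apply: ge1r_powR => //; rewrite invr_gt0 exprn_gt0// invf_le1 ?exprn_gt0// exprn_ege1.
- under eq_integral do rewrite EFinM.
  rewrite ge0_integralZl_EFin.
  + by rewrite -[leRHS]mule1 lee_wpmul2l ?lee_fin ?powR_ge0// integral_log_le.
  + exact: measurable_I01.
  + move=> x; rewrite /I01/= in_itv/= => /andP[x0 x1].
    by rewrite lee_fin divr_ge0 ?invr_ge0// sqr_ge0.
  + exact/measurable_EFinP.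
  + exact: powR_ge0.
Qed.

End Lp_power.

(** * Affine change of variables for Lebesgue measure *)

Section affine_change_of_variable.
Context {R : realType}.
Local Notation mu := (@lebesgue_measure R).
Variables (a b : R).
Hypothesis a0 : 0 < a.

Let phi (t : R) : measurableTypeR R := a * t + b.

Let measurable_phi : measurable_fun [set: measurableTypeR R] phi.
Proof. by apply: measurable_funD => //; exact: measurable_funM. Qed.

Let nu : {measure set (measurableTypeR R) -> \bar R} :=
  measure_function_pushforward__canonical__measure_function_Measure mu measurable_phi.

Lemma lebesgue_measure_affine (A : set R) : measurable A ->
  mu A = (a%:E * mu ((fun t => (a * t + b)%R) @^-1` A))%E.
Proof.
move=> mA.
transitivity (mscale (NngNum (ltW a0)) nu A) => //.
apply: lebesgue_measure_unique mA => //= _ [[c d]] _ <-.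
rewrite /mscale /nu /= /pushforward /=.
have -> : phi @^-1` `]c, d] = `](c - b) / a, (d - b) / a]%classic.
  apply/seteqP; split => t /=; rewrite !in_itv/= ltr_pdivrMr// ler_pdivlMr//;
    by rewrite /phi ltrBlDr lerBrDr mulrC.
rewrite !lebesgue_measure_itv/= !lte_fin ltr_pM2r ?invr_gt0// ltrD2r.
case: ifP => _; last by rewrite mule0.
by rewrite -!EFinB -EFinM; congr (_%:E); field; rewrite gt_eqF.
Qed.

Lemma ge0_integral_affine (f : R -> \bar R) (D : set R) : measurable D ->
  measurable_fun D f -> (forall x, D x -> (0 <= f x)%E) ->
  (\int[mu]_(y in D) f y =
   a%:E * \int[mu]_(t in (fun t => (a * t + b)%R) @^-1` D) f (a * t + b)%R)%E.
Proof.
move=> mD mf f0.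
transitivity (\int[mscale (NngNum (ltW a0)) nu]_(y in D) f y)%E.
  by apply: eq_measure_integral => A mA _; exact: lebesgue_measure_affine.
rewrite ge0_integral_mscale//; congr (_ * _)%E.
by rewrite ge0_integral_pushforward// => y /set_mem; exact: f0.
Qed.

End affine_change_of_variable.

(** Transports the essential bound on alpha_i to its composition with the inverse of u_i. *)
Lemma ae_affine {R : realType} (a b : R) (P : R -> Prop) : 0 < a ->
  {ae (@lebesgue_measure R), forall t, P t} ->
  {ae (@lebesgue_measure R), forall y, P ((y - b) / a)}.
Proof.
move=> a0 [N [mN N0 PN]].
have a1 : 0 < a^-1 by rewrite invr_gt0.
exists ((fun y => a^-1 * y + (- b / a)) @^-1` N); split.
- rewrite -[X in measurable X]setTI.
  by apply: measurable_funD => //; exact: measurable_funM.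
- have := lebesgue_measure_affine (- b / a) a1 mN; rewrite N0 => /esym/eqP.
  by rewrite mule_eq0 eqe gt_eqF//= => /eqP.
- move=> y /= h; apply: PN => /=.
  by have -> : a^-1 * y + - b / a = (y - b) / a by rewrite mulNr mulrBl mulrC.
Qed.

(** * Density of polynomials in L^p *)

Section Lp_density.
Context {R : realType}.
Local Notation mu := (@lebesgue_measure R).
Implicit Types (p : R) (f g : R -> R).

Lemma lebesgue_I01 : mu I01 = 1%E.
Proof. by rewrite /I01 lebesgue_measure_itv/= lte_fin ltr01 sube0. Qed.

Lemma cvge_lt_near (u : nat -> \bar R) (l y : \bar R) :
  u n @[n --> \oo] --> l -> (l < y)%E -> \forall n \near \oo, (u n < y)%E.
Proof. by move=> ul ly; exact: ul _ (open_ereal_lt' ly). Qed.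

Lemma LpNorm_dominated_cvg0 p (F : nat -> R -> R) (g : R -> R) : 0 < p ->
  (forall n, measurable_fun I01 (F n)) -> measurable_fun I01 g ->
  (LpNorm p g < +oo)%E ->
  (forall n x, I01 x -> `|F n x| <= `|g x|) ->
  (forall x, I01 x -> F n x @[n --> \oo] --> 0) ->
  forall e, 0 < e -> exists n, (LpNorm p (F n) <= e%:E)%E.
Proof.
move=> p0 mF mg gfin Fg F0 e e0.
have pp0 : 0 < p^-1 by rewrite invr_gt0.
have ig : mu.-integrable I01 (fun x => (`|g x| `^ p)%:E).
  apply/integrableP; split; first exact: measurable_normr_powR.
  under eq_integral do rewrite gee0_abs ?lee_fin ?powR_ge0//.
  by rewrite -LpNorm_poweR// poweR_lty.
have H : (\int[mu]_(x in I01) (`|F n x| `^ p)%:E @[n --> \oo] -->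
   \int[mu]_(x in I01) (cst 0%E x))%E.
  apply: (@dominated_cvg _ _ _ mu I01 _ _ _ (fun x => (`|g x| `^ p)%:E)) => //.
  - exact: measurable_I01.
  - by move=> n; exact: measurable_normr_powR.
  - move=> x xI; apply: cvg_EFin; first exact: nearW.
    apply/cvgrPdist_le => d d0 /=.
    have d1 : 0 < d `^ p^-1 by exact: powR_gt0.
    have /cvgr0_norm_le/(_ _ d1) := F0 x xI; apply: filterS => n hn.
    rewrite sub0r normrN ger0_norm ?powR_ge0//.
    have -> : d = (d `^ p^-1) `^ p by rewrite -powRrM mulVf ?gt_eqF// powRr1// ltW.
    by rewrite ge0_ler_powR ?nnegrE ?powR_ge0// ltW.
  - move=> n x xI /=; rewrite lee_fin ger0_norm ?powR_ge0//.
    by apply: ge0_ler_powR; rewrite ?nnegrE ?(ltW p0)//; exact: Fg.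
move: H; rewrite integral0 => H.
have ep0 : 0 < e `^ p by exact: powR_gt0.
have [n _ /(_ n (leqnn n)) /= hn] := cvge_lt_near H (ep0 : (0 < (e `^ p)%:E)%E).
by exists n; apply: LpNorm_le_integral; rewrite // ltW.
Qed.

(* Weights whose first moments telescope: this covers both the Bernstein and the
   negative binomial weights. *)
Lemma sum_moments (P t : nat -> R) (s w : R) : t 0%N = 0 ->
  (forall k, P k * (k%:R * s - w) = t k - t k.+1) -> forall K,
  \sum_(k < K) P k * (k%:R * s - w) = - t K /\
  \sum_(k < K) P k * (k%:R * s - w) ^+ 2 =
    s * (\sum_(k < K) t k) - t K * ((K%:R - 1) * s - w).
Proof.
move=> t0 Pt; elim=> [|K [IH1 IH2]]; first by rewrite !big_ord0 t0; split; ring.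
rewrite !big_ord_recr/= IH1 IH2 Pt expr2 [_ * (_ * _)]mulrA Pt -natr1; split; ring.
Qed.

Definition bernstein (n : nat) (g : R -> R) : {poly R} :=
  \sum_(k < n.+1) (g (k%:R / n%:R) * 'C(n, k)%:R) *: ('X^k * (1 - 'X) ^+ (n - k)).

Let bp n (x : R) k := 'C(n, k)%:R * x ^+ k * (1 - x) ^+ (n - k).

Lemma bernsteinE n g x : (bernstein n g).[x] =
  \sum_(k < n.+1) g (k%:R / n%:R) * bp n x k.
Proof.
rewrite /bernstein horner_sum; apply: eq_bigr => k _.
by rewrite /bp hornerZ hornerM hornerXn horner_exp !hornerE /= -!mulrA.
Qed.

Lemma bernstein_sum n x : \sum_(k < n.+1) bp n x k = 1.
Proof.
have := exprDn (1 - x) x n; rewrite subrK expr1n => ->.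
by apply: eq_bigr => k _; rewrite /bp -mulr_natl; ring.
Qed.

Lemma bernstein_moment2 n x :
  \sum_(k < n.+1) bp n x k * (k%:R - n%:R * x) ^+ 2 = n%:R * x * (1 - x).
Proof.
(* The telescoping quantity for [sum_moments] with s = 1 and w = n x; it vanishes at 0 and n + 1, so
   no boundary term remains. *)
pose t k := k%:R * (1 - x) * bp n x k.
have t0 : t 0%N = 0 by rewrite /t !mul0r.
have tn : t n.+1 = 0 by rewrite /t /bp bin_small// !mul0r mulr0.
have Pt k : bp n x k * (k%:R * 1 - n%:R * x) = t k - t k.+1.
  have [kn|nk] := ltnP k n; last first.
    have -> : t k.+1 = 0 by rewrite /t /bp bin_small// !mul0r mulr0.
    rewrite subr0 /t; move: nk; rewrite leq_eqVlt => /predU1P[->|nk].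
      ring.
    by rewrite /bp bin_small// !mul0r mulr0.
  have e : k.+1%:R * 'C(n, k.+1)%:R = (n%:R - k%:R) * 'C(n, k)%:R :> R.
    by rewrite -natrB 1?ltnW// -!natrM mul_bin_left.
  have -> : t k.+1 = (k.+1%:R * 'C(n, k.+1)%:R) * x ^+ k.+1 * ((1 - x) * (1 - x) ^+ (n - k.+1)).
    by rewrite /t /bp; ring.
  rewrite e -exprS subnSK// /t /bp exprS; ring.
have [h1 h2] := sum_moments t0 Pt n.+1.
move: h2; rewrite tn mul0r subr0 mul1r.
under eq_bigr do rewrite mulr1.
move=> ->.
have -> : \sum_(k < n.+1) t k = (1 - x) * \sum_(k < n.+1) (k%:R * bp n x k).
  by rewrite mulr_sumr; apply: eq_bigr => k _; rewrite /t mulrAC mulrC.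
have -> : \sum_(k < n.+1) (k%:R * bp n x k) = n%:R * x.
  move: h1; rewrite tn oppr0 => /eqP.
  under eq_bigr do rewrite mulr1 mulrBr.
  rewrite sumrB -mulr_suml bernstein_sum mul1r subr_eq0 => /eqP <-.
  by apply: eq_bigr => k _; rewrite mulrC.
by rewrite mulrC.
Qed.

Lemma bp_ge0 n x k : 0 <= x <= 1 -> 0 <= bp n x k.
Proof.
by move=> /andP[x0 x1]; rewrite /bp !mulr_ge0 ?exprn_ge0// subr_ge0.
Qed.

Lemma bernstein_bound n g x (M : R) : 0 <= x <= 1 -> (forall t, `|g t| <= M) ->
  `|(bernstein n g).[x]| <= M.
Proof.
move=> x01 gM; rewrite bernsteinE; apply: le_trans (ler_norm_sum _ _ _) _.
rewrite -[leRHS]mulr1 -(bernstein_sum n x) mulr_sumr; apply: ler_sum => k _.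
by rewrite normrM [X in _ * X]ger0_norm ?bp_ge0// ler_wpM2r ?bp_ge0.
Qed.

(** Pointwise convergence is enough: with the bound of [bernstein_bound], dominated convergence
    turns it into convergence in the L^p norm. *)
Lemma bernstein_cvg g x (M : R) : 0 <= x <= 1 -> (forall t, `|g t| <= M) ->
  {for x, continuous g} -> (bernstein n.+1 g).[x] @[n --> \oo] --> g x.
Proof.
move=> x01 gM gx; apply/cvgrPdist_le => e e0.
have M0 : 0 <= M by apply: le_trans (gM 0).
have e2 : 0 < e / 2 by lra.
have /cvgrPdist_le/(_ _ e2)/nbhs_ballP[d /= d0 gd] := gx.
pose K := 2 * M / d ^+ 2.
have K0 : 0 <= K by rewrite divr_ge0 ?sqr_ge0// mulr_ge0.
have gK t : `|g x - g t| <= e / 2 + K * (t - x) ^+ 2.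
  have [xt|xt] := ltP `|x - t| d.
    by rewrite (le_trans (gd t xt))// lerDl mulr_ge0// sqr_ge0.
  have h1 : `|g x - g t| <= 2 * M.
    by rewrite (le_trans (ler_normB _ _))// mulr_natl mulr2n lerD.
  apply: (le_trans h1); rewrite -[leLHS]add0r lerD ?(ltW e2)//.
  rewrite /K mulrAC ler_pdivlMr ?exprn_gt0// ler_wpM2l ?mulr_ge0//.
  by rewrite -[(t - x) ^+ 2]real_normK ?num_real// distrC lerXn2r ?nnegrE// ltW.
near=> n.
have n0 : 0 < n.+1%:R :> R by [].
rewrite bernsteinE.
have -> : g x - \sum_(k < n.+2) g (k%:R / n.+1%:R) * bp n.+1 x k =
   \sum_(k < n.+2) (g x - g (k%:R / n.+1%:R)) * bp n.+1 x k.
  rewrite -[in LHS](mulr1 (g x)) -{1}(bernstein_sum n.+1 x) mulr_sumr -sumrB.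
  by apply: eq_bigr => k _; rewrite mulrBl.
apply: le_trans (ler_norm_sum _ _ _) _.
apply: (@le_trans _ _ (\sum_(k < n.+2) (e / 2 * bp n.+1 x k +
   K / n.+1%:R ^+ 2 * (bp n.+1 x k * (k%:R - n.+1%:R * x) ^+ 2)))).
  apply: ler_sum => k _; rewrite normrM [X in _ * X]ger0_norm ?bp_ge0//.
  apply: le_trans (ler_wpM2r (bp_ge0 _ _ x01) (gK _)) _.
  rewrite le_eqVlt; apply/orP; left; apply/eqP; field; exact: lt0r_neq0.
rewrite big_split/= -!mulr_sumr bernstein_sum bernstein_moment2 mulr1.
rewrite [leRHS]splitr lerD2l.
have -> : K / n.+1%:R ^+ 2 * (n.+1%:R * x * (1 - x)) = K * (x * (1 - x)) / n.+1%:R.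
  by field; exact: lt0r_neq0.
rewrite ler_pdivrMr// (@le_trans _ _ K)//.
  by rewrite ler_piMr//; have /andP[? ?] := x01; nra.
rewrite mulrC -ler_pdivrMr//.
near: n; exists (Num.truncn (K / (e / 2))) => // n /= hn.
by apply: ltW; apply: lt_le_trans (truncnS_gt _) _; rewrite ler_nat.
Unshelve. all: by end_near. Qed.

End Lp_density.

Section Lp_polynomial_density.
Context {R : realType}.
Local Notation mu := (@lebesgue_measure R).
Implicit Types (p : R) (f g : R -> R).

Definition truncate (M t : R) := Num.max (- M) (Num.min M t).

Lemma truncate_le (M t : R) : 0 <= M -> `|truncate M t| <= M.
Proof.
by move=> M0; rewrite ler_norml /truncate le_max lexx/= ge_max ge_min lexx/= andbT; lra.
Qed.

Lemma truncate_id (M t : R) : `|t| <= M -> truncate M t = t.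
Proof.
by rewrite ler_norml => /andP[h1 h2]; rewrite /truncate (min_r h2) (max_r h1).
Qed.

Lemma truncate_lip (M s t : R) : `|truncate M s - truncate M t| <= `|s - t|.
Proof.
have h1 (a b c : R) : `|Num.max a b - Num.max a c| <= `|b - c|.
  by case: (lerP a b); case: (lerP a c) => *; rewrite ler_norml; case: (lerP b c) => *; apply/andP; split; lra.
have h2 (a b c : R) : `|Num.min a b - Num.min a c| <= `|b - c|.
  by case: (lerP a b); case: (lerP a c) => *; rewrite ler_norml; case: (lerP b c) => *; apply/andP; split; lra.
exact: le_trans (h1 _ _ _) (h2 _ _ _).
Qed.

Lemma truncate_dist (M t : R) : 0 <= M -> `|t - truncate M t| <= `|t|.
Proof.
move=> M0; rewrite /truncate; case: (lerP M t) => h1.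
  by case: (lerP (- M) M) => h2; rewrite ler_norml; case: (ler0P t) => h;
    apply/andP; split; lra.
by case: (lerP (- M) t) => h2; rewrite ler_norml; case: (ler0P t) => h;
    apply/andP; split; lra.
Qed.

Lemma continuous_truncate (M : R) : continuous (truncate M).
Proof.
move=> t; apply/cvgrPdist_le => e e0; near=> s.
apply: le_trans (truncate_lip _ _ _) _; near: s.
by apply: cvgr_dist_le => //; exact: cvg_id.
Unshelve. all: by end_near. Qed.

Lemma measurable_truncate M f (D : set R) : measurable_fun D f ->
  measurable_fun D (truncate M \o f).
Proof.
apply: measurableT_comp; apply: continuous_measurable_fun.
exact: continuous_truncate.
Qed.

Lemma LpNorm_truncate p f e : 0 < p -> inLp p f -> 0 < e ->
  exists2 M, 0 < M & (LpNorm p (fun x => (f x - truncate M (f x))%R) <= e%:E)%E.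
Proof.
move=> p0 [mf ff] e0.
have [|//|n x xI|x xI|n hn] := @LpNorm_dominated_cvg0 R p
   (fun n x => f x - truncate n.+1%:R (f x)) f p0 _ _ ff _ _ e e0.
- by move=> n; apply: measurable_funB => //; exact: measurable_truncate.
- exact: truncate_dist.
- apply/cvgrPdist_le => d d0; exists (Num.truncn `|f x|) => // n /= hn.
  rewrite truncate_id ?subrr ?subr0 ?normr0 ?(ltW d0)//.
  by apply: ltW; apply: lt_le_trans (truncnS_gt _) _; rewrite ler_nat.
- by exists n.+1%:R.
Qed.

(** Continuous functions approximate f in L^1. Truncating them at M only brings them closer to f,
    and then |f - g|^p <= (2 M)^(p - 1) |f - g| converts closeness in L^1 into closeness in L^p. *)
Lemma LpNorm_continuous_dense p f M e : 1 <= p -> measurable_fun I01 f -> 0 < M ->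
  (forall x, `|f x| <= M) -> 0 < e ->
  exists g, [/\ continuous g, (forall x, `|g x| <= M) &
    (LpNorm p (fun x => (f x - g x)%R) <= e%:E)%E].
Proof.
move=> p1 mf M0 fM e0; have p0 : 0 < p by lra.
have fin1 : (mu I01 < +oo)%E by rewrite lebesgue_I01 ltry.
have fi : mu.-integrable I01 (EFin \o f).
  apply: measurable_bounded_integrable => //.
  - exact: measurable_I01.
  - by exists M; split; [exact: num_real|move=> N MN x _ /=; rewrite (le_trans (fM x))// ltW].
have [g_ [cg gi g0]] := approximation_continuous_integrable measurable_I01 fin1 fi.
pose K := (2 * M) `^ (p - 1).
have K0 : 0 < K by apply: powR_gt0; lra.
have d0 : (0 < (e `^ p / K)%:E)%E by rewrite lte_fin divr_gt0// powR_gt0.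
have [n _ /(_ n (leqnn n)) /= hn] := cvge_lt_near g0 d0.
pose g := g_ n.
have cg' : continuous (truncate M \o g).
  move=> t; apply: continuous_comp; first exact: cg.
  exact: continuous_truncate.
have mg : measurable_fun I01 g.
  by apply: measurable_funTS; apply: continuous_measurable_fun; exact: cg.
exists (truncate M \o g); split => //.
  by move=> x; apply: truncate_le; exact: ltW.
apply: (@LpNorm_le_dominated _ p _ (fun x => K * `|f x - g x|)) => //.
- exact: ltW.
- by apply: measurable_funB => //; exact: measurable_truncate.
- by apply: measurable_funM => //; apply: measurableT_comp => //; exact: measurable_funB.
- by move=> x _; rewrite mulr_ge0// ltW.
- move=> x _ /=.
  have a1 : `|f x - truncate M (g x)| <= `|f x - g x|.
    by rewrite -{1}(truncate_id (fM x)); exact: truncate_lip.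
  have a2 : `|f x - truncate M (g x)| <= 2 * M.
    rewrite (le_trans (ler_normB _ _))// mulr_natl mulr2n lerD//.
    by apply: truncate_le; exact: ltW.
  rewrite -mulr_powRB1// mulrC ler_pM ?powR_ge0//.
  by apply: ge0_ler_powR; rewrite ?nnegrE//; lra.
- under eq_integral do rewrite EFinM.
  rewrite ge0_integralZl_EFin.
  + rewrite -lee_pdivlMl// -EFinM mulrC; exact: ltW.
  + exact: measurable_I01.
  + by [].
  + by apply/measurable_EFinP; apply: measurableT_comp => //; exact: measurable_funB.
  + exact: ltW.
Qed.

Lemma LpNorm_poly_dense p f e : 1 <= p -> inLp p f -> 0 < e ->
  exists P : {poly R}, (LpNorm p (fun x => (f x - P.[x])%R) <= e%:E)%E.
Proof.
move=> p1 fp e0; have p0 : 0 < p by lra.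
have e3 : 0 < e / 3 by lra.
have [mf _] := fp.
have [M M0 fM] := LpNorm_truncate p0 fp e3.
pose f1 := truncate M \o f.
have mf1 : measurable_fun I01 f1 by exact: measurable_truncate.
have f1M x : `|f1 x| <= M by apply: truncate_le; exact: ltW.
have [g [cg gM fg]] := LpNorm_continuous_dense p1 mf1 M0 f1M e3.
have mg : measurable_fun I01 g.
  by apply: measurable_funTS; exact: continuous_measurable_fun.
have mP (P : {poly R}) : measurable_fun I01 (fun x => P.[x]).
  by apply: measurable_funTS; apply: continuous_measurable_fun; exact: continuous_horner.
have finM : (LpNorm p (cst (2 * M)%R) < +oo)%E.
  rewrite LpNormE poweR_lty//=.
  have -> : (\int[mu]_(x in I01) (`|2 * M| `^ p)%:E = (`|2 * M| `^ p)%R%:E)%E.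
    rewrite integral_cst; last exact: measurable_I01.
    by rewrite -[RHS]mule1; congr (_ * _)%E; exact: lebesgue_I01.
  exact: ltry.
have [|//|n x xI|x xI|n hn] := @LpNorm_dominated_cvg0 R p
   (fun n x => g x - (bernstein n.+1 g).[x]) (cst (2 * M)) p0 _ _ finM _ _ _ e3.
- by move=> n; exact: measurable_funB.
- rewrite (le_trans (ler_normB _ _))// (le_trans _ (ler_norm _))// mulr_natl mulr2n lerD//.
  exact: bernstein_bound.
- rewrite -[X in _ --> X](subrr (g x)); apply: cvgB; first exact: cvg_cst.
  by apply: (@bernstein_cvg _ _ _ M) => //; exact: cg.
exists (bernstein n.+1 g).
have -> : (fun x => f x - (bernstein n.+1 g).[x]) =
   (fun x => (f x - f1 x) + ((f1 x - g x) + (g x - (bernstein n.+1 g).[x]))).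
  by apply/funext => x; ring.
have m1 : measurable_fun I01 (fun x => f x - f1 x) by exact: measurable_funB.
have m2 : measurable_fun I01 (fun x => f1 x - g x) by exact: measurable_funB.
have m3 : measurable_fun I01 (fun x => g x - (bernstein n.+1 g).[x]) by exact: measurable_funB.
apply: le_trans (LpNormD p1 m1 (measurable_funD m2 m3)) _.
have -> : e = e / 3 + (e / 3 + e / 3) by field.
rewrite !EFinD; apply: leeD; first exact: fM.
by apply: le_trans (LpNormD p1 m2 m3) _; apply: leeD.
Qed.

End Lp_polynomial_density.

(** * Negative binomial weights and the MKZ kernel *)

Section negative_binomial.
Context {R : realType}.

(** The probability of k successes before failure number n + 1, for success probability x. By
    [mhat_nb] it is the mass that the kernel of index [n.+1] puts on [Ik n.+1 k]. *)
Definition nb (n : nat) (x : R) (k : nat) : R :=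
  'C(k + n, k)%:R * x ^+ k * (1 - x) ^+ n.+1.

Variable x : R.
Hypothesis x01 : 0 < x < 1.

Let x0 : 0 < x. Proof. by case/andP: x01. Qed.
Let x1 : x < 1. Proof. by case/andP: x01. Qed.
Let y0 : 0 < 1 - x. Proof. by rewrite subr_gt0. Qed.

Lemma nb_ge0 n k : 0 <= nb n x k.
Proof. by rewrite /nb !mulr_ge0 ?exprn_ge0// ltW. Qed.

(** Pascal's rule summed over k. The boundary term is nonnegative, which bounds the partial sums by
    1 inductively, and tends to 0, which gives their limit 1. *)
Lemma nb_sumS n K : \sum_(k < K.+1) nb n.+1 x k =
  \sum_(k < K.+1) nb n x k - nb n.+1 x K * (x / (1 - x)).
Proof.
have yn0 : 1 - x != 0 by rewrite gt_eqF.
elim: K => [|K IH].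
  by rewrite !big_ord1 /nb !bin0 !exprS; field.
rewrite big_ord_recr/= IH [in RHS]big_ord_recr/=.
have e : 'C(K.+1 + n.+1, K.+1)%:R = 'C(K.+1 + n, K.+1)%:R + 'C(K + n.+1, K)%:R :> R.
  by rewrite -natrD addnS addSn binS addnS.
by rewrite /nb e !exprS; field.
Qed.

Lemma nb_sum_le1 n K : \sum_(k < K) nb n x k <= 1.
Proof.
elim: n K => [|n IH] K.
  have -> : \sum_(k < K) nb 0 x k = 1 - x ^+ K.
    elim: K => [|K IH]; first by rewrite big_ord0 subrr.
    by rewrite big_ord_recr/= IH /nb addn0 binn !exprS; ring.
  by rewrite gerBl exprn_ge0// ltW.
case: K => [|K]; first by rewrite big_ord0.
rewrite nb_sumS; apply: le_trans (IH K.+1).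
by rewrite gerBl mulr_ge0 ?nb_ge0// divr_ge0// ltW.
Qed.

Lemma nb_sum_cvg n : \sum_(k < K) nb n x k @[K --> \oo] --> (1 : R).
Proof.
elim: n => [|n IH].
  have -> : (fun K => \sum_(k < K) nb 0 x k) = (fun K => 1 - x ^+ K).
    apply/funext; elim=> [|K IH]; first by rewrite big_ord0 subrr.
    by rewrite big_ord_recr/= IH /nb addn0 binn !exprS; ring.
  rewrite -[X in _ --> X]subr0; apply: cvgB; first exact: cvg_cst.
  by apply: cvg_expr; rewrite ger0_norm// ltW.
have sE : (fun K => \sum_(k < K) nb n.+1 x k) = series (nb n.+1 x).
  by apply/funext => K; rewrite /series/= big_mkord.
have nb0 : nb n.+1 x K @[K --> \oo] --> (0 : R).
  apply: cvg_series_cvg_0; rewrite -sE; apply: nondecreasing_is_cvgn.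
    apply/nondecreasing_seqP => K; rewrite big_ord_recr/= lerDl; exact: nb_ge0.
  by exists 1 => _ [K _ <-]; exact: nb_sum_le1.
have : (\sum_(k < K.+1) nb n x k - nb n.+1 x K * (x / (1 - x))) @[K --> \oo]
    --> (1 - 0 * (x / (1 - x)) : R).
  apply: cvgB; last exact: cvgMl.
  by rewrite (cvg_shiftS (fun K => \sum_(k < K) nb n x k)).
rewrite mul0r subr0 => H.
rewrite -(cvg_shiftS (fun K => \sum_(k < K) nb n.+1 x k)).
by under eq_cvg do rewrite /= nb_sumS.
Qed.

Lemma nb_rec n k : k.+1%:R * nb n x k.+1 = (k + n.+1)%:R * x * nb n x k.
Proof.
have e : k.+1%:R * 'C(k.+1 + n, k.+1)%:R = (k + n.+1)%:R * 'C(k + n, k)%:R :> R.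
  by rewrite -!natrM -mul_bin_diag addnS addSn.
by rewrite /nb !mulrA e exprS; ring.
Qed.

(** The centred variable k (1 - x) - (n + 1) x is k + n + 1 times the distance from x to the left
    endpoint k / (k + n + 1) of the interval; this scaling avoids dividing by 1 - x. *)
Lemma nb_moment2 n K :
  \sum_(k < K) nb n x k * (k%:R * (1 - x) - n.+1%:R * x) ^+ 2 <= n.+1%:R * x.
Proof.
pose t k := k%:R * nb n x k.
have t0 : t 0%N = 0 by rewrite /t mul0r.
have tge0 k : 0 <= t k by rewrite mulr_ge0 ?nb_ge0.
have Pt k : nb n x k * (k%:R * (1 - x) - n.+1%:R * x) = t k - t k.+1.
  by rewrite /t nb_rec natrD; ring.
(* Adding nonnegative terms, the range is enlarged to an L beyond the mean, where the boundary term
   of [sum_moments] has the favourable sign. *)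
have [L [LK Lx]] : exists L, (K <= L)%N /\ 0 <= (L%:R - 1) * (1 - x) - n.+1%:R * x.
  pose L0 := (Num.truncn (n.+1%:R * x / (1 - x))).+1.
  exists (K + L0.+1)%N; rewrite leq_addr; split => //.
  rewrite subr_ge0 -ler_pdivrMr//; apply: (@le_trans _ _ L0%:R).
    by apply: ltW; exact: truncnS_gt.
  by rewrite natrD -natr1 addrA addrK lerDr.
apply: (@le_trans _ _ (\sum_(k < L) nb n x k * (k%:R * (1 - x) - n.+1%:R * x) ^+ 2)).
  rewrite -(subnKC LK) big_split_ord/= lerDl; apply: sumr_ge0 => k _.
  by rewrite mulr_ge0 ?nb_ge0// sqr_ge0.
have [h1 h2] := sum_moments t0 Pt L.
rewrite h2; apply: (@le_trans _ _ ((1 - x) * \sum_(k < L) t k)).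
  by rewrite gerBl mulr_ge0.
have -> : (1 - x) * \sum_(k < L) t k = n.+1%:R * x * \sum_(k < L) nb n x k - t L.
  rewrite -h1 !mulr_sumr -big_split/=; apply: eq_bigr => k _; rewrite /t; ring.
apply: (@le_trans _ _ (n.+1%:R * x * \sum_(k < L) nb n x k)); first by rewrite gerBl.
by rewrite ler_piMr ?nb_sum_le1// mulr_ge0// ltW.
Qed.

(* [x (k + n + 1) / (k + 1)] is the ratio of two consecutive weights. *)
Lemma nb_inverse_moment n K :
  \sum_(k < K) nb n x k * (x * (k + n.+1)%:R / k.+1%:R) <= 1.
Proof.
apply: le_trans (nb_sum_le1 n K.+1).
rewrite big_ord_recl/= -[leLHS]add0r lerD ?nb_ge0//.
apply: ler_sum => k _; rewrite /bump/= add1n.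
have -> : nb n x k.+1 = (k.+1%:R)^-1 * (k.+1%:R * nb n x k.+1) by rewrite mulKf.
by rewrite nb_rec le_eqVlt; apply/orP; left; apply/eqP; field; rewrite addrC natr1.
Qed.

Lemma mhat_nb n k : mhat n.+1 k x *
  (k.+1%:R / (k + n.+1).+1%:R - k%:R / (k + n.+1)%:R) = nb n x k.
Proof.
have e m : m.+1%:R * 'C(k + m.+1, k)%:R = (k + m.+1)%:R * 'C(k + m, k)%:R :> R.
  rewrite -!natrM; congr (_%:R).
  by have := mul_bin_down (k + m.+1) k; rewrite addKn addnS /= => <-.
have e1 := e n.+1; have e2 := e n.
rewrite /mhat /nb -addnA addn1 e1 [(k + n.+2)%N]addnS.
have -> : 'C(k + n.+1, k)%:R = (n.+1%:R)^-1 * ((k + n.+1)%:R * 'C(k + n, k)%:R) :> R.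
  by rewrite -e2 mulKf.
have k0 : (k + n.+1)%:R != 0 :> R by rewrite addnS.
rewrite -[(k + n.+1).+1]addn1 -[k.+1]addn1 [((k + n.+1) + 1)%:R]natrD [(k + 1)%:R]natrD.
have k1 : (k + n.+1)%:R + 1 != 0 :> R by rewrite natr1.
have n0 : n.+1%:R != 0 :> R by [].
have eK : k%:R = (k + n.+1)%:R - n.+1%:R :> R by rewrite natrD addrK.
rewrite eK; move: k0 k1 n0; move: ((k + n.+1)%:R) (n.+1%:R) => A B *.
by field; apply/and3P.
Qed.

End negative_binomial.

(** * Modulus of continuity of power functions *)

Section powR_modulus.
Context {R : realType}.

(** For d <= c <= 1 the factor c^(lam - 1) of the derivative is at most d^(-(|lam| + 1)), whatever
    the sign of lam. *)
Lemma powR_lipschitz (lam d s x : R) : 0 < d -> d <= s <= 1 -> d <= x <= 1 ->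
  `|s `^ lam - x `^ lam| <= `|lam| * d `^ (- (`|lam| + 1)) * `|s - x|.
Proof.
move=> d0.
wlog sx : s x / s <= x.
  move=> H hs hx; have [sx|/ltW xs] := leP s x; first exact: H.
  by rewrite distrC [`|s - x|]distrC; apply: H.
move=> /andP[ds s1] /andP[dx x1].
have [||c] := @MVT_segment R (fun t => t `^ lam) (fun t => lam * t `^ (lam - 1)) s x sx.
- move=> t; rewrite in_itv/= => /andP[st tx].
  by apply: is_derive1_powR; lra.
- apply: derivable_within_continuous => t; rewrite in_itv/= => /andP[st tx].
  by apply: derivable_powR; rewrite in_itv/= andbT; lra.
rewrite in_itv/= => /andP[sc cx] e.
rewrite distrC e normrM normrM [`|s - x|]distrC -!mulrA ler_wpM2l// ler_wpM2r//.
have c0 : 0 < c by lra.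
rewrite ger0_norm ?powR_ge0//.
apply: (@le_trans _ _ (c `^ (- (`|lam| + 1)))).
  apply: ger_powR; first by rewrite c0/=; lra.
  by have := ler_norm (- lam); rewrite normrN; lra.
rewrite !powRN lef_pV2 ?posrE ?powR_gt0//.
by apply: ge0_ler_powR; rewrite ?nnegrE//; have := normr_ge0 lam; lra.
Qed.

(** Below the cut d one has t^lam = t^(lam - lam') t^lam' <= eta t^lam', which fixes d; above it the
    power is Lipschitz. Passing from t to max(t, d) splits the difference into these two cases. *)
Lemma powR_modulus (lam lam' eta : R) : lam' < 0 -> lam' < lam -> 0 < eta ->
  exists2 L, 0 <= L & forall s x, 0 < s <= 1 -> 0 < x <= 1 ->
    `|s `^ lam - x `^ lam| <= eta * (s `^ lam' + x `^ lam') + L * `|s - x|.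
Proof.
move=> l0 ll e0.
pose d := Num.min 1 (eta `^ (lam - lam')^-1).
have d0 : 0 < d by rewrite lt_min ltr01 powR_gt0.
have d1 : d <= 1 by rewrite ge_min lexx.
have de : d `^ (lam - lam') <= eta.
  have -> : eta = (eta `^ (lam - lam')^-1) `^ (lam - lam').
    by rewrite -powRrM mulVf ?powRr1 ?(ltW e0)// subr_eq0 gt_eqF.
  apply: ge0_ler_powR; rewrite ?nnegrE ?powR_ge0//; [lra|exact: ltW|].
  by rewrite ge_min lexx orbT.
have small t u : 0 < t -> t <= u -> u <= d -> u `^ lam <= eta * t `^ lam'.
  move=> t0 tu ud; have u0 : 0 < u := lt_le_trans t0 tu.
  have -> : lam = (lam - lam') + lam' by ring.
  rewrite powRD; last by rewrite (lt0r_neq0 u0) implybT.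
  apply: ler_pM; rewrite ?powR_ge0//.
    apply: le_trans de; apply: ge0_ler_powR; rewrite ?nnegrE//; lra.
  have : t `^ (- lam') <= u `^ (- lam').
    by apply: ge0_ler_powR; rewrite ?nnegrE; lra.
  by rewrite !powRN lef_pV2 ?posrE ?powR_gt0.
pose m t := Num.max t d.
have mE t : 0 < t <= 1 -> d <= m t <= 1 /\ `|t `^ lam - m t `^ lam| <= eta * t `^ lam'.
  move=> /andP[t0 t1]; rewrite /m; case: (lerP t d) => td.
    split; first by rewrite lexx.
    have h1 := small t t t0 (lexx _) td; have h2 := small t d t0 td (lexx _).
    have h3 := powR_ge0 t lam; have h4 := powR_ge0 d lam.
    by case: (lerP (t `^ lam) (d `^ lam)) => h; lra.
  split; first by rewrite (ltW td).
  by rewrite subrr normr0 mulr_ge0 ?powR_ge0// ltW.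
have mlip s x : `|m s - m x| <= `|s - x|.
  rewrite /m; case: (lerP s d); case: (lerP x d); case: (lerP s x) => *;
    by rewrite ?ler_norml; try (apply/andP; split); lra.
set L := `|lam| * d `^ (- (`|lam| + 1)).
have L0 : 0 <= L by rewrite mulr_ge0// powR_ge0.
exists L => // s x /mE[ms hs] /mE[mx hx].
have h := powR_lipschitz lam d0 ms mx; rewrite -/L in h.
have h' : L * `|m s - m x| <= L * `|s - x| by exact: ler_wpM2l.
have -> : s `^ lam - x `^ lam = (s `^ lam - m s `^ lam) +
  ((m s `^ lam - m x `^ lam) + - (x `^ lam - m x `^ lam)) by ring.
apply: le_trans (ler_normD _ _) _.
have := ler_normD (m s `^ lam - m x `^ lam) (- (x `^ lam - m x `^ lam)).
rewrite [`|- _|]normrN; lra.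
Qed.

End powR_modulus.

(** * The MKZ kernel as a series *)

Section kernel.
Context {R : realType}.

Lemma finite_series_limn (a : nat -> R) (K : nat) : (forall k, (K <= k)%N -> a k = 0) ->
  limn (series a) = \sum_(k < K) a k.
Proof.
move=> aK; apply: lim_near_cst => //.
exists K => // n /= Kn; rewrite /series/= big_mkord -(subnKC Kn) big_split_ord/=.
by rewrite [X in _ + X]big1 ?addr0// => i _; rewrite aK// leq_addr.
Qed.

Lemma finite_nneseries (a : nat -> \bar R) (K : nat) :
  (forall k, (K <= k)%N -> a k = 0%E) ->
  (\sum_(k <oo) a k = \sum_(k < K) a k)%E.
Proof.
move=> aK; apply: lim_near_cst => //.
exists K => // n /= Kn; rewrite big_mkord -(subnKC Kn) big_split_ord/=.
by rewrite [X in (_ + X)%E]big1 ?adde0// => i _; rewrite aK// leq_addr.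
Qed.

Lemma sub_Ik_I01 n k : Ik n.+1 k `<=` (I01 : set R).
Proof.
move=> s; rewrite /Ik/I01/= !in_itv/= => /andP[h1 h2].
rewrite (le_trans _ h1) ?divr_ge0//= (le_trans h2)// ler_pdivrMr// mul1r ler_nat.
by rewrite ltnS leq_addr.
Qed.

(** The left endpoints tend to 1, so a point s < 1 meets finitely many intervals, and s = 1 meets
    none. The limit defining [Hn] is therefore a finite sum at each point of [I01]. *)
Lemma Ik_finite n (s : R) : I01 s -> exists K, forall k, (K <= k)%N ->
  \1_(Ik n.+1 k) s = 0 :> R.
Proof.
rewrite /I01/= in_itv/= => /andP[s0]; rewrite le_eqVlt => /predU1P[->|s1].
  exists 0%N => k _; rewrite indicE memNset// /Ik/= in_itv/= => /andP[_].
  by rewrite ler_pdivlMr// mul1r ler_nat ltnS addnS ltnNge leq_addr.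
have d0 : 0 < 1 - s by rewrite subr_gt0.
exists (Num.truncn (s * n.+1%:R / (1 - s))).+1 => k hk.
rewrite indicE memNset// /Ik/= in_itv/= => /andP[+ _].
have kn : 0 < (k + n.+1)%:R :> R by rewrite addnS.
rewrite ler_pdivrMr// natrD mulrDr => h.
have : k%:R <= s * n.+1%:R / (1 - s) by rewrite ler_pdivlMr//; lra.
apply/negP; rewrite -ltNge; apply: lt_le_trans (truncnS_gt _) _.
by rewrite ler_nat.
Qed.

Lemma Hn_nneseries n (x c s : R) : I01 s ->
  ((Hn n.+1 x s * c)%:E =
   \sum_(k <oo) (mhat n.+1 k x * \1_(Ik n.+1 k) s * c)%:E)%E.
Proof.
move=> /(Ik_finite n)[K hK].
rewrite /Hn (@finite_series_limn _ K) => [|k /hK ->]; last by rewrite mulr0.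
rewrite (@finite_nneseries _ K) => [|k /hK ->]; last by rewrite mulr0 mul0r.
by rewrite mulr_suml sumEFin.
Qed.

Variables (n : nat) (x : R).
Hypothesis x01 : 0 < x < 1.

Lemma mhat_ge0 k : 0 <= mhat n k x.
Proof.
have /andP[x0 x1] := x01.
by rewrite /mhat !mulr_ge0 ?exprn_ge0// ltW// subr_gt0.
Qed.

End kernel.

Section kernel_integral.
Context {R : realType}.
Local Notation mu := (@lebesgue_measure R).
Variables (n : nat) (x : R).
Hypothesis x01 : 0 < x < 1.

Lemma measurable_Ik k : measurable (Ik n.+1 k : set R).
Proof. exact: measurable_itv. Qed.

Lemma measurable_Hn_term (w : R -> R) k : measurable_fun I01 w ->
  measurable_fun I01 (fun s => mhat n.+1 k x * \1_(Ik n.+1 k) s * w s).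
Proof.
move=> mw; apply: measurable_funM => //; apply: measurable_funM => //.
by apply: measurable_indic; exact: measurable_Ik.
Qed.

Lemma Hn_term_ge0 (c s : R) k : 0 <= c -> 0 <= mhat n.+1 k x * \1_(Ik n.+1 k) s * c.
Proof.
move=> c0; apply: mulr_ge0 => //; apply: mulr_ge0; first exact: mhat_ge0.
by rewrite indicE.
Qed.

Lemma measurable_Hn (w : R -> R) : measurable_fun I01 w ->
  (forall s, I01 s -> 0 <= w s) -> measurable_fun I01 (fun s => Hn n.+1 x s * w s).
Proof.
move=> mw w0; apply/measurable_EFinP.
apply: (@eq_measurable_fun _ _ _ _ _ (fun s =>
   \sum_(k <oo | k \in xpredT) (mhat n.+1 k x * \1_(Ik n.+1 k) s * w s)%:E)%E).
  by move=> s /set_mem sI; rewrite /= Hn_nneseries.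
apply: ge0_emeasurable_sum.
  by move=> k s sI _; rewrite lee_fin Hn_term_ge0// w0.
by move=> k _; apply/measurable_EFinP; exact: measurable_Hn_term.
Qed.

Lemma integral_Hn (w : R -> R) : measurable_fun I01 w ->
  (forall s, I01 s -> 0 <= w s) ->
  (\int[mu]_(s in I01) (Hn n.+1 x s * w s)%:E =
   \sum_(k <oo) ((mhat n.+1 k x)%:E * \int[mu]_(s in Ik n.+1 k) (w s)%:E))%E.
Proof.
move=> mw w0.
transitivity (\int[mu]_(s in I01) (\sum_(k <oo)
    (mhat n.+1 k x * \1_(Ik n.+1 k) s * w s)%:E))%E.
  by apply: eq_integral => s /set_mem sI; rewrite Hn_nneseries.
rewrite integral_nneseries; last 3 first.
- exact: measurable_I01.
- by move=> k; apply/measurable_EFinP; exact: measurable_Hn_term.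
- by move=> k s sI; rewrite lee_fin Hn_term_ge0// w0.
apply: eq_eseriesr => k _.
rewrite -ge0_integralZl_EFin; last 4 first.
- exact: measurable_Ik.
- by move=> s /sub_Ik_I01 sI; rewrite lee_fin w0.
- apply/measurable_EFinP; apply: measurable_funS mw; first exact: measurable_I01.
  exact: sub_Ik_I01.
- exact: mhat_ge0.
rewrite -[in RHS](setIidr (@sub_Ik_I01 R n k)) integral_mkcondr.
apply: eq_integral => s _; rewrite /patch indicE.
by case: ifP => _; rewrite ?mulr1 ?mulr0 ?mul0r.
Qed.

Definition Ik_length k : R := k.+1%:R / (k + n.+1).+1%:R - k%:R / (k + n.+1)%:R.

Lemma Ik_length_le k : 0 <= Ik_length k <= n.+1%:R^-1.
Proof.
rewrite /Ik_length.
have k0 : 0 < (k + n.+1)%:R :> R by rewrite addnS.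
have k1 : 0 < (k + n.+1).+1%:R :> R by [].
have n0 : 0 < n.+1%:R :> R by [].
have -> : k.+1%:R / (k + n.+1).+1%:R - k%:R / (k + n.+1)%:R =
   n.+1%:R / ((k + n.+1)%:R * (k + n.+1).+1%:R) :> R.
  have eK : k%:R = (k + n.+1)%:R - n.+1%:R :> R by rewrite natrD addrK.
  rewrite -[in k.+1%:R]natr1 -[in (k + n.+1).+1%:R]natr1 in k1 *.
  by rewrite eK; field; rewrite !gt_eqF.
rewrite divr_ge0 ?mulr_ge0//= ler_pdivrMr ?mulr_gt0//.
rewrite mulrC ler_pdivlMr// ler_pM//.
- by rewrite ler_nat leq_addl.
- by rewrite ler_nat leqW// leq_addl.
Qed.

Lemma lebesgue_Ik k : mu (Ik n.+1 k) = (Ik_length k)%:E.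
Proof.
have /andP[l0 _] := Ik_length_le k.
rewrite /Ik lebesgue_measure_itv/= lte_fin -subr_gt0 -/(Ik_length k).
move: l0; rewrite le_eqVlt => /predU1P[<-|l0]; first by rewrite ltxx.
by rewrite l0 -EFinB.
Qed.

(** Reduces a kernel average to a bound B k for the mean of w over the k-th interval and the
    expectation of B under the negative binomial law. *)
Lemma integral_Hn_le (w : R -> R) (B : nat -> R) (C : R) : measurable_fun I01 w ->
  (forall s, I01 s -> 0 <= w s) ->
  (forall k, \int[mu]_(s in Ik n.+1 k) (w s)%:E <= (B k * Ik_length k)%:E)%E ->
  (forall K, \sum_(k < K) nb n x k * B k <= C) ->
  (\int[mu]_(s in I01) (Hn n.+1 x s * w s)%:E <= C%:E)%E.
Proof.
move=> mw w0 wB BC; rewrite integral_Hn//; apply: lime_le.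
  apply: is_cvg_nneseries => k _ _; apply: mule_ge0; first by rewrite lee_fin mhat_ge0.
  by apply: integral_ge0 => s /sub_Ik_I01 sI; rewrite lee_fin w0.
apply: nearW => K; rewrite big_mkord.
apply: (@le_trans _ _ (\sum_(k < K) (nb n x k * B k)%:E)%E).
  apply: lee_sum => k _.
  have -> : nb n x k * B k = mhat n.+1 k x * (B k * Ik_length k).
    by rewrite -mhat_nb -/(Ik_length k); ring.
  rewrite [leRHS]EFinM; apply: lee_wpmul2l; last exact: wB.
  by rewrite lee_fin mhat_ge0.
by rewrite sumEFin lee_fin.
Qed.

Lemma integral_Ik_le (w : R -> R) k (b : R) : measurable_fun I01 w ->
  (forall s, I01 s -> 0 <= w s) -> (forall s, Ik n.+1 k s -> w s <= b) ->
  (\int[mu]_(s in Ik n.+1 k) (w s)%:E <= (b * Ik_length k)%:E)%E.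
Proof.
move=> mw w0 wb; rewrite EFinM -lebesgue_Ik -integral_cst; last exact: measurable_Ik.
apply: ge0_le_integral.
- exact: measurable_Ik.
- by move=> s /sub_Ik_I01 sI; rewrite lee_fin w0.
- apply/measurable_EFinP; apply: measurable_funS mw; first exact: measurable_I01.
  exact: sub_Ik_I01.
- exact: measurable_cst.
- by move=> s sI /=; rewrite lee_fin wb.
Qed.

Lemma integral_Hn1 : (\int[mu]_(s in I01) (Hn n.+1 x s)%:E = 1)%E.
Proof.
transitivity (\int[mu]_(s in I01) (Hn n.+1 x s * 1)%:E)%E.
  by apply: eq_integral => s _; rewrite mulr1.
rewrite (@integral_Hn (fun=> 1)) => [|//|//].
apply/cvg_lim => //.
have := nb_sum_cvg x01 n => H.
have -> : (fun K => \sum_(0 <= k < K)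
    ((mhat n.+1 k x)%:E * \int[mu]_(s in Ik n.+1 k) 1%:E))%E =
    EFin \o (fun K => \sum_(k < K) nb n x k).
  apply/funext => K; rewrite big_mkord /= -sumEFin; apply: eq_bigr => k _.
  transitivity ((mhat n.+1 k x)%:E * (Ik_length k)%:E)%E.
    congr (_ * _)%E; rewrite integral_cst; last exact: measurable_Ik.
    by rewrite mul1e; exact: lebesgue_Ik.
  by rewrite -EFinM mhat_nb.
by apply: cvg_EFin => //; exact: nearW.
Qed.

End kernel_integral.

(** * Kernel averages of negative powers and of the distance to x *)

Section kernel_estimates.
Context {R : realType}.
Local Notation mu := (@lebesgue_measure R).

Lemma bernoulli_inequality (t : R) N : 0 <= t -> 1 + N%:R * t <= (1 + t) ^+ N.
Proof.
move=> t0; elim: N => [|N IH]; first by rewrite mul0r addr0.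
rewrite exprS; apply: le_trans (ler_wpM2l _ IH); last lra.
have : 0 <= N%:R * t * t by rewrite !mulr_ge0.
by rewrite -natr1; lra.
Qed.

Lemma powR_le_addr1 (a t : R) : 0 <= t -> 0 <= a <= 1 -> t `^ a <= 1 + t.
Proof.
move=> t0 /andP[a0 a1]; have [t1|/ltW t1] := leP t 1.
  have : t `^ a <= 1 `^ a by apply: ge0_ler_powR; rewrite ?nnegrE.
  by rewrite powR1; lra.
by have := ler1_powR t1 a1; lra.
Qed.

(** Linearising (x / s)^a <= 1 + x / s leaves only the mean of x / s, which [nb_inverse_moment]
    controls. *)
Lemma powR_neg_le (a s x : R) : 0 < s -> 0 < x -> 0 <= a <= 1 ->
  s `^ (- a) <= x `^ (- a) * (1 + x / s).
Proof.
move=> s0 x0 a01.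
have -> : s `^ (- a) = x `^ (- a) * (x / s) `^ a.
  rewrite powRM ?invr_ge0 ?(ltW x0) ?(ltW s0)// mulrA -powRD; last by rewrite (lt0r_neq0 x0) implybT.
  by rewrite addNr powRr0 mul1r -powR_inv1 ?(ltW s0)// -powRrM mulN1r.
by rewrite ler_wpM2l ?powR_ge0// powR_le_addr1// divr_ge0 ?ltW.
Qed.

Variables (n : nat) (x : R).
Hypothesis x01 : 0 < x < 1.
Let x0 : 0 < x. Proof. by case/andP: x01. Qed.
Let x1 : x < 1. Proof. by case/andP: x01. Qed.

(** For k >= 1 the left endpoint bounds s from below and 1/k <= 2/(k + 1), giving 1 + 2 = 3. On the
    interval k = 0 the power is unbounded, so its exact mean (n + 2)^a / (1 - a) is used. The 2
    there comes from (1 + (n + 2) x)(1 - x)^(n + 1) <= 2: Bernoulli's inequality gives 1 for 1 + (n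
    + 1) x, and the remaining x (1 - x)^(n + 1) is at most 1. *)
Lemma integral_Hn_power (a : R) : 0 < a < 1 ->
  (\int[mu]_(s in I01) (Hn n.+1 x s * s `^ (- a))%:E
     <= (x `^ (- a) * (3 + 2 / (1 - a)))%:E)%E.
Proof.
have /andP[hx0 hx1] := x01; move=> /andP[a0 a1].
have a01 : 0 <= a <= 1 by rewrite !ltW.
have a1' : 0 < 1 - a by lra.
have N0 : 0 < n.+2%:R :> R by [].
pose B0 : R := n.+2%:R `^ a / (1 - a).
have B00 : 0 <= B0 by rewrite divr_ge0 ?powR_ge0// ltW.
pose B k : R := (k == 0%N)%:R * B0 +
  x `^ (- a) * (1 + 2 * (x * (k + n.+1)%:R / k.+1%:R)).
have w0 s : I01 s -> 0 <= s `^ (- a) by move=> _; exact: powR_ge0.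
apply: (@integral_Hn_le R n x x01 _ B) => //; first exact: measurable_powR_id.
- move=> [|k].
    have /andP[l0 _] := @Ik_length_le R n 0.
    have -> : Ik n.+1 0 = `[0%R, n.+2%:R^-1]%classic :> set R by rewrite /Ik mul0r mul1r.
    apply: (le_trans (@integral_powR_le _ (- a) n.+2%:R^-1 _ _)); rewrite ?invr_gt0//; first lra.
    have lE : Ik_length n 0 = n.+2%:R^-1 :> R by rewrite /Ik_length mul0r subr0 mul1r.
    rewrite lee_fin; apply: (@le_trans _ _ (B0 * Ik_length n 0)).
      rewrite lE /B0 le_eqVlt; apply/orP; left; apply/eqP.
      rewrite powRD; last by rewrite invr_eq0 (lt0r_neq0 N0) implybT.
      rewrite powRr1 ?invr_ge0// -[in _^-1 `^ _]powR_inv1// -powRrM mulN1r opprK.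
      by rewrite [- a + 1]addrC; field; rewrite !gt_eqF.
    rewrite ler_wpM2r// /B mul1r lerDl mulr_ge0 ?powR_ge0//.
    by rewrite addr_ge0// mulr_ge0// divr_ge0// mulr_ge0// ltW.
  apply: integral_Ik_le => //; first exact: measurable_powR_id.
  move=> s; rewrite /Ik/= in_itv/= => /andP[ks _].
  have kN : 0 < (k.+1 + n.+1)%:R :> R by rewrite addSn.
  have k1 : 0 < k.+1%:R :> R by [].
  have k2 : 0 < k.+2%:R :> R by [].
  have s0 : 0 < s by apply: lt_le_trans ks; rewrite divr_gt0.
  apply: (le_trans (powR_neg_le s0 x0 a01)).
  rewrite /B mul0r add0r ler_wpM2l ?powR_ge0// lerD2l.
  have -> : 2 * (x * (k.+1 + n.+1)%:R / k.+2%:R) = x * (2 * (k.+1 + n.+1)%:R / k.+2%:R).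
    by ring.
  rewrite ler_pM2l// -[s^-1]div1r ler_pdivrMr//.
  apply: (@le_trans _ _ (2 * (k.+1 + n.+1)%:R / k.+2%:R * (k.+1%:R / (k.+1 + n.+1)%:R))); last first.
    by rewrite ler_wpM2l// divr_ge0// mulr_ge0.
  have -> : 2 * (k.+1 + n.+1)%:R / k.+2%:R * (k.+1%:R / (k.+1 + n.+1)%:R) = 2 * k.+1%:R / k.+2%:R :> R.
    by field; rewrite !lt0r_neq0.
  rewrite ler_pdivlMr// mul1r -natrM ler_nat mul2n -addnn.
  by rewrite addSn addnS !ltnS leq_addl.
- move=> K.
  have -> : \sum_(k < K) nb n x k * B k =
     \sum_(k < K) nb n x k * ((k == 0%N :> nat)%:R * B0) +
     x `^ (- a) * (\sum_(k < K) nb n x k +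
       2 * \sum_(k < K) nb n x k * (x * (k + n.+1)%:R / k.+1%:R)).
    rewrite mulr_sumr -!big_split/= mulr_sumr -big_split/=; apply: eq_bigr => k _.
    by rewrite /B; ring.
  rewrite [3 + _]addrC [leRHS]mulrDr; apply: lerD; last first.
    rewrite ler_wpM2l ?powR_ge0//.
    by have := nb_sum_le1 x01 n K; have := nb_inverse_moment x01 n K; lra.
  have h0 : nb n x 0 * B0 <= x `^ (- a) * (2 / (1 - a)).
    have h1 := @powR_le_addr1 a (x * n.+2%:R) (mulr_ge0 (ltW x0) (ler0n _ _)) a01.
    have -> : nb n x 0 * B0 = x `^ (- a) * (((x * n.+2%:R) `^ a * (1 - x) ^+ n.+1) / (1 - a)).
      rewrite powRM ?(ltW hx0)// powRN /nb bin0 expr0 /B0 !mul1r.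
      by field; rewrite !lt0r_neq0// powR_gt0.
    rewrite ler_wpM2l ?powR_ge0// ler_wpM2r ?invr_ge0 ?(ltW a1')//.
    have y0 : 0 <= (1 - x) ^+ n.+1 by rewrite exprn_ge0//; lra.
    apply: (le_trans (ler_wpM2r y0 h1)).
    have y1 : (1 - x) ^+ n.+1 <= 1 by rewrite exprn_ile1//; lra.
    have b1 := @bernoulli_inequality x n.+1 (ltW x0).
    have b2 : (1 + x) ^+ n.+1 * (1 - x) ^+ n.+1 <= 1.
      rewrite -exprMn exprn_ile1//; first by rewrite mulr_ge0//; lra.
      by have : 0 <= x * x; [rewrite mulr_ge0// ltW|lra].
    have b3 := ler_wpM2r y0 b1.
    have b4 : x * (1 - x) ^+ n.+1 <= 1 by rewrite mulr_ile1//; lra.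
    by rewrite -(natr1 n.+1); lra.
  case: K => [|K]; first by rewrite big_ord0 (le_trans _ h0)// mulr_ge0// nb_ge0.
  rewrite big_ord_recl/= mul1r big1 ?addr0// => k _.
  by rewrite mul0r mulr0.
Qed.

(** The inequality v <= th + v^2 / th replaces the first absolute moment by the second. The interval
    length costs 1/(n + 1), and the second moment another th^(-1) / (n + 1). *)
Lemma integral_Hn_dist (th : R) : 0 < th ->
  (\int[mu]_(s in I01) (Hn n.+1 x s * `|s - x|)%:E
     <= (th + (1 + th^-1) / n.+1%:R)%:E)%E.
Proof.
have /andP[hx0 hx1] := x01; move=> th0; have N0 : 0 < n.+1%:R :> R by [].
set N : R := n.+1%:R in N0 *.
pose B k : R := N^-1 + th + th^-1 * N^-1 ^+ 2 * (k%:R * (1 - x) - N * x) ^+ 2.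
have mw : measurable_fun I01 (fun s : R => `|s - x|).
  by apply: measurableT_comp => //; exact: measurable_funB.
apply: (@integral_Hn_le R n x x01 _ B) => //.
- move=> k; apply: integral_Ik_le => // s; rewrite /Ik/= in_itv/= => /andP[h1 h2].
  have kN : 0 < (k + n.+1)%:R :> R by rewrite addnS.
  have /andP[_ l1] := @Ik_length_le R n k.
  have e : k%:R / (k + n.+1)%:R - x = (k%:R * (1 - x) - N * x) / (k + n.+1)%:R.
    by rewrite natrD -/N in kN *; field; rewrite gt_eqF.
  set d := k%:R * (1 - x) - N * x in e.
  have hd : `|k%:R / (k + n.+1)%:R - x| <= `|d| / N.
    rewrite e normrM ler_wpM2l// gtr0_norm ?invr_gt0// lef_pV2 ?posrE//.
    by rewrite ler_nat leq_addl.
  have hd2 : `|d| / N <= th + th^-1 * N^-1 ^+ 2 * d ^+ 2.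
    set v := `|d| / N.
    have -> : th^-1 * N^-1 ^+ 2 * d ^+ 2 = v ^+ 2 / th.
      by rewrite /v expr_div_n real_normK ?num_real//; field; rewrite !gt_eqF.
    have v0 : 0 <= v by rewrite divr_ge0// ltW.
    have [vt|/ltW vt] := leP v th; first by rewrite -[leLHS]addr0 lerD// divr_ge0 ?sqr_ge0// ltW.
    rewrite -[leLHS]add0r lerD ?(ltW th0)// ler_pdivlMr// expr2 ler_wpM2l//.
  have hs : `|s - k%:R / (k + n.+1)%:R| <= N^-1.
    rewrite ger0_norm ?subr_ge0//; apply: le_trans l1; rewrite /Ik_length.
    by rewrite lerD2r.
  have -> : s - x = (s - k%:R / (k + n.+1)%:R) + (k%:R / (k + n.+1)%:R - x) by ring.
  apply: le_trans (ler_normD _ _) _.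
  by apply: (le_trans (lerD hs (le_trans hd hd2))); rewrite addrA.
- move=> K.
  have -> : \sum_(k < K) nb n x k * B k = (N^-1 + th) * (\sum_(k < K) nb n x k) +
     th^-1 * N^-1 ^+ 2 * \sum_(k < K) nb n x k * (k%:R * (1 - x) - N * x) ^+ 2.
    by rewrite !mulr_sumr -big_split/=; apply: eq_bigr => k _; rewrite /B; ring.
  have h1 := nb_sum_le1 x01 n K; have h2 := nb_moment2 x01 n K.
  have c0 : 0 <= N^-1 + th by rewrite addr_ge0 ?invr_ge0 ?ltW.
  have c1 : 0 <= th^-1 * N^-1 ^+ 2 by rewrite mulr_ge0 ?invr_ge0 ?exprn_ge0 ?invr_ge0 ?ltW.
  apply: (@le_trans _ _ ((N^-1 + th) * 1 + th^-1 * N^-1 ^+ 2 * (N * 1))).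
    rewrite lerD// ler_wpM2l// (le_trans h2)// ler_wpM2l// ltW//.
  rewrite le_eqVlt; apply/orP; left; apply/eqP; field; rewrite !gt_eqF//.
Qed.

Lemma integral_HnD (w1 w2 : R -> R) (C1 C2 : R) :
  measurable_fun I01 w1 -> measurable_fun I01 w2 ->
  (forall s, I01 s -> 0 <= w1 s) -> (forall s, I01 s -> 0 <= w2 s) ->
  (\int[mu]_(s in I01) (Hn n.+1 x s * w1 s)%:E <= C1%:E)%E ->
  (\int[mu]_(s in I01) (Hn n.+1 x s * w2 s)%:E <= C2%:E)%E ->
  (\int[mu]_(s in I01) (Hn n.+1 x s * (w1 s + w2 s))%:E <= (C1 + C2)%:E)%E.
Proof.
move=> m1 m2 p1 p2 h1 h2.
have H0 w s : I01 s -> (forall s, I01 s -> 0 <= w s) -> (0 <= (Hn n.+1 x s * w s)%:E)%E.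
  move=> sI w0; rewrite Hn_nneseries//; apply: nneseries_ge0 => k _ _.
  by rewrite lee_fin Hn_term_ge0// w0.
under eq_integral do rewrite mulrDr EFinD.
rewrite ge0_integralD.
- by rewrite EFinD leeD.
- exact: measurable_I01.
- by move=> s sI; exact: H0.
- by apply/measurable_EFinP; exact: measurable_Hn.
- by move=> s sI; exact: H0.
- by apply/measurable_EFinP; exact: measurable_Hn.
Qed.

Lemma integral_HnZ (w : R -> R) (c C : R) : 0 <= c -> measurable_fun I01 w ->
  (forall s, I01 s -> 0 <= w s) ->
  (\int[mu]_(s in I01) (Hn n.+1 x s * w s)%:E <= C%:E)%E ->
  (\int[mu]_(s in I01) (Hn n.+1 x s * (c * w s))%:E <= (c * C)%:E)%E.
Proof.
move=> c0 mw w0 h.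
under eq_integral do rewrite mulrCA EFinM.
rewrite ge0_integralZl_EFin//.
- by rewrite EFinM lee_wpmul2l.
- exact: measurable_I01.
- move=> s sI; rewrite Hn_nneseries//; apply: nneseries_ge0 => k _ _.
  by rewrite lee_fin Hn_term_ge0// w0.
- by apply/measurable_EFinP; exact: measurable_Hn.
Qed.

Lemma Mn_powR_error (lam lam' eta L th : R) : - 1 < lam' < 0 -> 0 <= eta -> 0 <= L ->
  0 < th ->
  (forall s, 0 < s <= 1 ->
    `|s `^ lam - x `^ lam| <= eta * (s `^ lam' + x `^ lam') + L * `|s - x|) ->
  `|Mn n.+1 (fun s => s `^ lam) x - x `^ lam| <=
    eta * (4 + 2 / (1 + lam')) * x `^ lam' + L * (th + (1 + th^-1) / n.+1%:R).
Proof.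
move=> /andP[l1 l0] eta0 L0 th0 hmod.
set H := Hn n.+1 x; set h := fun s : R => s `^ lam.
pose w s := eta * (s `^ lam' + x `^ lam') + L * `|s - x|.
set C := (X in _ <= X).
have la0 : 0 < - lam' < 1 by apply/andP; split; lra.
have mh : measurable_fun I01 h by exact: measurable_powR_id.
have mp : measurable_fun I01 (fun s : R => s `^ lam') by exact: measurable_powR_id.
have md : measurable_fun I01 (fun s : R => `|s - x|).
  by apply: measurableT_comp => //; exact: measurable_funB.
have c0 : 0 <= x `^ lam' by exact: powR_ge0.
have mpc : measurable_fun I01 (fun s : R => s `^ lam' + x `^ lam') by exact: measurable_funD.
have mw : measurable_fun I01 w by apply: measurable_funD; exact: measurable_funM.
have H1 : (\int[mu]_(s in I01) (H s * x `^ lam')%:E <= (x `^ lam' * 1)%:E)%E.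
  have := @integral_HnZ (fun=> 1) (x `^ lam') 1 c0.
  rewrite mulr1; apply => //.
  under eq_integral do rewrite mulr1.
  by rewrite integral_Hn1.
have Hw : (\int[mu]_(s in I01) (H s * w s)%:E <= C%:E)%E.
  have -> : C = eta * (x `^ lam' * (3 + 2 / (1 + lam')) + x `^ lam' * 1) +
     L * (th + (1 + th^-1) / n.+1%:R) by rewrite /C; ring.
  apply: integral_HnD.
  - exact: measurable_funM.
  - exact: measurable_funM.
  - by move=> s _; rewrite mulr_ge0// addr_ge0 ?powR_ge0.
  - by move=> s _; rewrite mulr_ge0.
  - apply: integral_HnZ => //; first by move=> s _; rewrite addr_ge0 ?powR_ge0.
    apply: integral_HnD => //; first by move=> s _; rewrite powR_ge0.
    by have := integral_Hn_power la0; rewrite !opprK.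
  - by apply: integral_HnZ => //; exact: integral_Hn_dist.
have H0 s : I01 s -> 0 <= H s.
  move=> sI; rewrite -[H s]mulr1 -lee_fin Hn_nneseries//; apply: nneseries_ge0 => k _ _.
  by rewrite lee_fin Hn_term_ge0.
pose D s := `|h s - h x|.
have HD0 s : I01 s -> 0 <= H s * D s.
  by move=> sI; apply: mulr_ge0; [exact: H0|exact: normr_ge0].
have w0 s : 0 <= w s.
  by apply: addr_ge0; apply: mulr_ge0 => //; rewrite addr_ge0 ?powR_ge0.
have mD : measurable_fun I01 D by apply: measurableT_comp => //; exact: measurable_funB.
have mHD : measurable_fun I01 (fun s => H s * D s).
  by apply: measurable_Hn => // s _; exact: normr_ge0.
have HD : (\int[mu]_(s in I01) (H s * D s)%:E <= C%:E)%E.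
  apply: le_trans Hw; apply: ae_ge0_le_integral.
  - exact: measurable_I01.
  - by move=> s sI; rewrite lee_fin HD0.
  - exact/measurable_EFinP.
  - by move=> s sI; rewrite lee_fin; apply: mulr_ge0; [exact: H0|exact: w0].
  - by apply/measurable_EFinP; exact: measurable_Hn.
  apply: filterS (ae_neq 0) => s s0 sI; rewrite lee_fin.
  apply: ler_wpM2l; first exact: H0.
  move: sI; rewrite /I01/= in_itv/= => /andP[s0' s1].
  by apply: hmod; rewrite s1 andbT lt_neqAle eq_sym s0.
(* [Mn] is a real-valued integral, so linearity requires integrability. That of H h follows from the
   total mass 1 of H and the finite bound C for the integral of H |h - h x|. *)
have mH : measurable_fun I01 H.
  have := @measurable_Hn R n x x01 (fun=> 1); rewrite (_ : (fun s => _ * 1) = H); last first.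
    by apply/funext => s; rewrite mulr1.
  by apply.
have iH : mu.-integrable I01 (EFin \o H).
  apply/integrableP; split; first exact/measurable_EFinP.
  apply: (@le_lt_trans _ _ (\int[mu]_(s in I01) (H s)%:E)%E).
    rewrite le_eqVlt; apply/orP; left; apply/eqP; apply: eq_integral => s /set_mem sI.
    by rewrite gee0_abs// lee_fin H0.
  by rewrite integral_Hn1// ltry.
have iHD : mu.-integrable I01 (EFin \o (fun s => H s * D s)).
  apply/integrableP; split; first exact/measurable_EFinP.
  apply: (@le_lt_trans _ _ (\int[mu]_(s in I01) (H s * D s)%:E)%E).
    rewrite le_eqVlt; apply/orP; left; apply/eqP; apply: eq_integral => s /set_mem sI.
    by rewrite gee0_abs// lee_fin HD0.
  by apply: le_lt_trans HD _; exact: ltry.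
have iHc : mu.-integrable I01 (EFin \o (fun s => H s * h x)).
  have -> : EFin \o (fun s => H s * h x) = ((EFin \o H) \* cst (h x)%:E)%E by [].
  by apply: integrableZr => //; exact: measurable_I01.
have iHd : mu.-integrable I01 (EFin \o (fun s => H s * (h s - h x))).
  apply: le_integrable iHD.
  - exact: measurable_I01.
  - by apply/measurable_EFinP; apply: measurable_funM => //; exact: measurable_funB.
  - by move=> s sI /=; rewrite lee_fin !normrM normr_id.
have iHh : mu.-integrable I01 (EFin \o (fun s => H s * h s)).
  have -> : EFin \o (fun s => H s * h s) =
     ((EFin \o (fun s => (H s * (h s - h x))%R)) \+ (EFin \o (fun s => (H s * h x)%R)))%E.
    by apply/funext => s; rewrite /= -EFinD -mulrDr subrK.
  by apply: integrableD => //; exact: measurable_I01.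
have E1 : Mn n.+1 h x - h x = Rintegral mu I01 (fun s => H s * (h s - h x)).
  have EC : h x = Rintegral mu I01 (fun s => H s * h x).
    rewrite RintegralZr//; last exact: measurable_I01.
    by rewrite /Rintegral integral_Hn1// mul1r.
  rewrite /Mn -/H {1}EC -RintegralB//; last exact: measurable_I01.
  by apply: eq_Rintegral => s _; rewrite mulrBr.
rewrite E1 -lee_fin; apply: le_trans (HD).
apply: (@le_trans _ _ (Rintegral mu I01 (fun s => `|H s * (h s - h x)|))%:E).
  by rewrite lee_fin; apply: le_normr_Rintegral => //; exact: measurable_I01.
have EI : (\int[mu]_(s in I01) (`|H s * (h s - h x)|)%:E =
    \int[mu]_(s in I01) (H s * D s)%:E)%E.
  by apply: eq_integral => s /set_mem sI; rewrite normrM ger0_norm ?H0.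
rewrite /Rintegral EI fineK// ge0_fin_numE; first exact: le_lt_trans (HD) (ltry _).
by apply: integral_ge0 => s sI; rewrite lee_fin HD0.
Qed.

End kernel_estimates.

Section Mn_powR.
Context {R : realType}.

Lemma LpNorm_cst_le p (K : R) : 0 < p -> (LpNorm p (fun=> K) <= `|K|%:E)%E.
Proof.
move=> p0; apply: LpNorm_le_integral => //.
rewrite integral_cst; last exact: measurable_I01.
rewrite -[leRHS]mule1 le_eqVlt; apply/orP; left; apply/eqP.
by congr (_ * _)%E; exact: lebesgue_I01.
Qed.

(** lam' > - 1/p puts x^lam' in L^p and, as p >= 1, gives lam' > -1, which the kernel average needs.
    The Lipschitz constant L depends on eta, so eta is fixed first, then th, then n. The error is
    dominated by an explicit E, whose measurability is immediate. *)
Lemma Mn_powR_Lp p (lam e : R) : 1 <= p -> - p^-1 < lam -> 0 < e ->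
  exists n0, forall n, (n0 <= n)%N -> exists E : R -> R,
  [/\ measurable_fun I01 E,
      forall x, 0 < x < 1 -> `|Mn n.+1 (fun s => s `^ lam) x - x `^ lam| <= E x &
      (LpNorm p E <= e%:E)%E].
Proof.
move=> p1 plam e0; have p0 : 0 < p by lra.
have pi0 : 0 < p^-1 by rewrite invr_gt0.
have pi1 : p^-1 <= 1 by rewrite invf_le1.
pose lam' := (- p^-1 + Num.min lam 0) / 2.
have [h1 h2] : Num.min lam 0 <= lam /\ Num.min lam 0 <= 0.
  by rewrite !ge_min !lexx orbT.
have h3 : - p^-1 < Num.min lam 0 by rewrite lt_min plam oppr_lt0.
have l1 : - p^-1 < lam' by rewrite /lam'; lra.
have l2 : lam' < lam by rewrite /lam'; lra.
have l3 : lam' < 0 by rewrite /lam'; lra.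
have l4 : -1 < lam' by lra.
pose Q := (p * lam' + 1)^-1 `^ p^-1.
have Q0 : 0 <= Q by exact: powR_ge0.
pose C := 4 + 2 / (1 + lam').
have C0 : 0 < C by rewrite ltr_wpDr// divr_ge0//; lra.
pose eta := e / (2 * C * (Q + 1)).
have Q1 : 0 < Q + 1 by lra.
have eta0 : 0 < eta by rewrite divr_gt0// !mulr_gt0.
have [L L0 hL] := powR_modulus l3 l2 eta0.
pose th := e / (4 * (L + 1)).
have L1 : 0 < L + 1 by lra.
have th0 : 0 < th by rewrite divr_gt0// mulr_gt0.
exists (Num.truncn ((1 + th^-1) / th)) => n hn.
have N0 : 0 < n.+1%:R :> R by [].
have hN : (1 + th^-1) / n.+1%:R <= th.
  rewrite ler_pdivrMr// mulrC -ler_pdivrMr//.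
  by apply: ltW; apply: lt_le_trans (truncnS_gt _) _; rewrite ler_nat ltnS.
pose K := L * (th + (1 + th^-1) / n.+1%:R).
have K0 : 0 <= K.
  by rewrite mulr_ge0// addr_ge0 ?(ltW th0)// divr_ge0// addr_ge0// invr_ge0 ltW.
have Ke : K <= e / 2.
  apply: (@le_trans _ _ ((L + 1) * (th + th))).
    apply: ler_pM => //; last by rewrite lerD2l.
      by rewrite addr_ge0 ?(ltW th0)// divr_ge0// addr_ge0// invr_ge0 ltW.
    by rewrite lerDl.
  rewrite /th le_eqVlt; apply/orP; left; apply/eqP; field; rewrite gt_eqF//.
have mpow : measurable_fun I01 (fun x : R => x `^ lam') by exact: measurable_powR_id.
exists (fun x => eta * C * x `^ lam' + K); split.
- by apply: measurable_funD => //; exact: measurable_funM.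
- move=> x x01; apply: Mn_powR_error => //.
  + by rewrite l4.
  + exact: ltW.
  + move=> s s01; apply: hL => //.
    by case/andP: x01 => -> /ltW ->.
- have m1 : measurable_fun I01 (fun x : R => eta * C * x `^ lam') by exact: measurable_funM.
  have m2 : measurable_fun I01 (fun _ : R => K) by exact: measurable_cst.
  apply: le_trans (LpNormD p1 m1 m2) _.
  have -> : e = eta * C * (Q + 1) + e / 2.
    by rewrite /eta; field; rewrite !gt_eqF.
  rewrite EFinD; apply: leeD; last first.
    by apply: le_trans (LpNorm_cst_le K p0) _; rewrite ger0_norm// lee_fin.
  have ec0 : 0 <= eta * C by rewrite mulr_ge0// ltW.
  rewrite LpNormZ// EFinM; apply: lee_pmul => //.
  + exact: LpNorm_ge0.
  + by rewrite lee_fin ger0_norm.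
  + apply: le_trans (LpNorm_powR_le p0 l1) _; rewrite lee_fin -/Q; lra.
Qed.

End Mn_powR.

Section fractal.
Context {R : realType}.
Local Notation mu := (@lebesgue_measure R).

Lemma ae_muI (P : R -> Prop) : {ae (muI R), forall t, P t} ->
  {ae mu, forall t, I01 t -> P t}.
Proof.
move=> [N [mN N0 PN]]; exists (N `&` I01); split.
- by apply: measurableI => //; exact: measurable_I01.
- exact: N0.
- move=> t /= h; split; first by apply: PN => /= Pt; apply: h.
  by apply: contrapT => tI; apply: h.
Qed.

Lemma ae_LinfNorm (f : R -> R) : inLinf f ->
  0 <= fine (LinfNorm f) /\ {ae mu, forall t, I01 t -> `|f t| <= fine (LinfNorm f)}.
Proof.
move=> [mf ff]; have f0 : (0 <= LinfNorm f)%E by exact: Lnorm_ge0.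
split; first exact: fine_ge0.
have fin : LinfNorm f \is a fin_num by rewrite ge0_fin_numE.
apply: ae_muI.
have := ess_sup_ge (muI R) (abse \o (EFin \o f)).
have -> : ess_sup (muI R) (abse \o (EFin \o f)) = LinfNorm f.
  (* The norm at infinity is the essential supremum when the measure has positive total mass; here
     the mass is 1. *)
  rewrite /LinfNorm unlock ifT// /muI /= /mrestr setTI.
  by rewrite [X in (0 < X)%E]lebesgue_I01.
have F1 := @ae_filter_ringOfSetsType _ _ _ (muI R).
apply: filterS => t /=; rewrite -(fineK fin); by rewrite lee_fin fineK.
Qed.

Lemma ae_forall_lt (P : nat -> R -> Prop) N :
  (forall i, (i < N)%N -> {ae mu, forall t, P i t}) ->
  {ae mu, forall t, forall i, (i < N)%N -> P i t}.
Proof.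
elim: N => [|N IH] h; first by apply: nearW.
have h1 := IH (fun i iN => h i (ltnW iN)); have h2 := h N (ltnSn N).
apply: filterS2 h1 h2 => t t1 t2 i; rewrite ltnS leq_eqVlt => /predU1P[->//|].
exact: t1.
Qed.

Lemma powR_norm_sum_le (N : nat) (c d : nat -> R) p : 0 < p ->
  (forall i j, (i < N)%N -> (j < N)%N -> c i != 0 -> c j != 0 -> i = j) ->
  (forall i, 0 <= d i) -> (forall i, (i < N)%N -> `|c i| `^ p <= d i) ->
  `|\sum_(i < N) c i| `^ p <= \sum_(i < N) d i.
Proof.
move=> p0 uniq d0 cd.
have [[j cj]|nc] := pselect (exists j : 'I_N, c j != 0).
  rewrite (bigD1 j)//= big1 ?addr0 => [|i ij].
    rewrite (bigD1 j)//= (le_trans (cd j _))// lerDl; exact: sumr_ge0.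
  apply/eqP; apply: contraT => ci; move/negP: ij; case.
  by apply/eqP/val_inj; exact: (uniq i j).
rewrite big1 => [|i _].
  by rewrite normr0 powR0 ?gt_eqF//; exact: sumr_ge0.
by apply/eqP; apply: contraT => ci; case: nc; exists i.
Qed.

End fractal.

(** * The alpha-fractal perturbation *)

Section fractal_estimate.
Context {R : realType}.
Local Notation mu := (@lebesgue_measure R).
Variables (p : R) (N : nat) (x a b : nat -> R) (alpha : nat -> R -> R).
Hypothesis p1 : 1 <= p.
Hypothesis x_0 : x 0%N = 0.
Hypothesis x_N : x N = 1.
Hypothesis x_incr : forall i, (i < N)%N -> x i < x i.+1.
Hypothesis ab : forall i, (1 <= i <= N)%N ->
  a i * 0 + b i = x i.-1 /\ a i * 1 + b i = x i.
Hypothesis alpha_inf : forall i, (1 <= i <= N)%N -> inLinf (alpha i).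

Let A i := fine (LinfNorm (alpha i)).

Let p0 : 0 < p. Proof. exact: lt_le_trans p1. Qed.

Let bE i : (i < N)%N -> b i.+1 = x i.
Proof. by move=> iN; have [] := @ab i.+1 iN; rewrite mulr0 add0r. Qed.

Let aE i : (i < N)%N -> a i.+1 = x i.+1 - x i.
Proof. by move=> iN; have [_] := @ab i.+1 iN; rewrite mulr1 bE// => <-; rewrite addrK. Qed.

Let a_gt0 i : (i < N)%N -> 0 < a i.+1.
Proof. by move=> iN; rewrite aE// subr_gt0 x_incr. Qed.

Let x_mono i j : (i <= j)%N -> (j <= N)%N -> x i <= x j.
Proof.
elim: j => [|j IH]; first by rewrite leqn0 => /eqP ->.
rewrite leq_eqVlt => /predU1P[->//|ij] jN.
by apply: le_trans (ltW (x_incr jN)); apply: IH => //; exact: ltnW.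
Qed.

Let A_ge0 i : (i < N)%N -> 0 <= A i.+1.
Proof. by move=> iN; have [] := ae_LinfNorm (@alpha_inf i.+1 iN). Qed.

Let piece i := ((fun t => a i.+1 * t + b i.+1) @` I01) : set R.

Let pieceE i : (i < N)%N -> piece i = `[x i, x i.+1]%classic.
Proof.
move=> iN; have ai := a_gt0 iN; apply/seteqP; split => y /=.
  move=> [t]; rewrite /I01/= in_itv/= => /andP[t0 t1] <-; rewrite in_itv/= bE// aE//.
  rewrite aE// in ai; apply/andP; split; first by rewrite lerDr mulr_ge0// ltW.
  by rewrite -lerBrDr ler_piMr// ltW.
rewrite in_itv/= => /andP[y0 y1]; exists ((y - b i.+1) / a i.+1).
  rewrite /I01/= in_itv/= ler_pdivrMr// mul1r divr_ge0 ?(ltW ai)//= ?bE// ?subr_ge0//.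
  by rewrite aE// lerD2r.
by rewrite mulrC divfK ?subrK// gt_eqF.
Qed.

Let preimage_piece i : (i < N)%N ->
  (fun t => a i.+1 * t + b i.+1) @^-1` (piece i) = I01.
Proof.
move=> iN; have ai := a_gt0 iN; rewrite pieceE//; apply/seteqP; split => t /=;
  rewrite /I01/= !in_itv/= bE// aE//; rewrite aE// in ai.
  move=> /andP[t0 t1]; rewrite lerDr pmulr_rge0// in t0; rewrite t0/=.
  by rewrite -lerBrDr ger_pMr// in t1.
by move=> /andP[t0 t1]; rewrite lerDr pmulr_rge0// t0/= -lerBrDr ger_pMr.
Qed.

Let piece_sub i : (i < N)%N -> piece i `<=` I01.
Proof.
move=> iN y; rewrite pieceE// /I01/= !in_itv/= => /andP[y0 y1].
by rewrite -x_0 (le_trans _ y0) ?x_mono ?(ltnW iN)//= -x_N (le_trans y1)// x_mono.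
Qed.

Let piece_disjoint y i j : (i < N)%N -> (j < N)%N ->
  (forall k, (k < N)%N -> y != x k) -> piece i y -> piece j y -> i = j.
Proof.
move=> iN jN yx.
wlog ij : i j iN jN / (i < j)%N.
  by move=> H yi yj; case: (ltngtP i j) => // h; [exact: H|apply/esym; exact: H].
rewrite !pieceE//= !in_itv/= => /andP[_ y1] /andP[y2 _].
have := yx j jN; rewrite eq_le y2 andbT.
by rewrite (le_trans y1)// x_mono// ltnW.
Qed.

Let mW_piece (W : R -> R) i : (i < N)%N -> measurable_fun I01 W ->
  measurable_fun (piece i) (fun y => W ((y - b i.+1) / a i.+1)).
Proof.
move=> iN mW; have ai := a_gt0 iN.
apply: (measurable_comp measurable_I01 _ mW).
  move=> _ [y yi <-]; rewrite -(preimage_piece iN)/=.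
  by rewrite mulrC divfK ?subrK// gt_eqF.
by apply: measurable_funM => //; exact: measurable_funB.
Qed.

Let measurable_piece i : (i < N)%N -> measurable (piece i).
Proof. by move=> iN; rewrite pieceE//; exact: measurable_itv. Qed.

(** The Jacobian of u_i supplies the factor a_i, so that the pieces together add up to Λ^p. *)
Lemma integral_piece (W : R -> R) i : (i < N)%N -> measurable_fun I01 W ->
  (\int[mu]_(y in I01)
     (A i.+1 `^ p * `|W ((y - b i.+1) / a i.+1)| `^ p * \1_(piece i) y)%:E =
   (a i.+1 * A i.+1 `^ p)%:E * \int[mu]_(t in I01) (`|W t| `^ p)%:E)%E.
Proof.
move=> iN mW; have ai := a_gt0 iN.
have mp := measurable_piece iN; have mWc := mW_piece iN mW.
transitivity (\int[mu]_(y in piece i)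
   (A i.+1 `^ p * `|W ((y - b i.+1) / a i.+1)| `^ p)%:E)%E.
  rewrite -[in RHS](setIidr (piece_sub iN)) integral_mkcondr.
  apply: eq_integral => y _; rewrite /patch indicE.
  by case: ifP => _; rewrite ?mulr1 ?mulr0.
rewrite (@ge0_integral_affine R (a i.+1) (b i.+1) ai) => //.
- rewrite preimage_piece// EFinM -muleA; congr (_ * _)%E.
  rewrite -ge0_integralZl_EFin.
  + by apply: eq_integral => t _; rewrite addrK mulrAC divff ?mul1r ?EFinM// gt_eqF.
  + exact: measurable_I01.
  + by move=> t _; rewrite lee_fin powR_ge0.
  + exact: measurable_normr_powR.
  + exact: powR_ge0.
- apply/measurable_EFinP; apply: measurable_funM => //.
  by apply/measurable_EFinP; exact: measurable_normr_powR.
- by move=> y _; rewrite lee_fin mulr_ge0 ?powR_ge0.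
Qed.

Let Lambda := (\sum_(1 <= i < N.+1) a i * A i `^ p) `^ p^-1.

(* Off the partition points at most one piece contributes at [y]. Excluding them
   also keeps [u_i^-1 y] away from [0] and [1], where [Mn n h] is not controlled. *)
Lemma fractal_contraction n (h G E : R -> R) :
  is_alpha_fractal p N a b alpha n h G -> measurable_fun I01 h ->
  measurable_fun I01 E -> (forall t, 0 < t < 1 -> `|Mn n h t - h t| <= E t) ->
  (LpNorm p (fun y => (G y - h y)%R) <=
     Lambda%:E * LpNorm p (fun y => (`|G y - h y| + E y)%R))%E.
Proof.
move=> [[mG _] GE] mh mE hE.
pose D y := G y - h y.
pose W y := `|D y| + E y.
have mD : measurable_fun I01 D by exact: measurable_funB.
have mW : measurable_fun I01 W.
  by apply: measurable_funD => //; exact: measurableT_comp.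
pose d i y := A i.+1 `^ p * `|W ((y - b i.+1) / a i.+1)| `^ p * \1_(piece i) y.
have d0 i y : 0 <= d i y by rewrite /d indicE !mulr_ge0 ?powR_ge0.
have md i : (i < N)%N -> measurable_fun I01 (d i).
  move=> iN; have mp := measurable_piece iN; have mWc := mW_piece iN mW.
  have -> : d i = (fun y => A i.+1 `^ p * `|W ((y - b i.+1) / a i.+1)| `^ p) \_ (piece i).
    apply/funext => y; rewrite /d /patch indicE.
    by case: ifP => _; rewrite ?mulr1 ?mulr0.
  apply/(measurable_restrict _ mp measurable_I01).
  rewrite (setIidr (piece_sub iN)); apply: measurable_funM => //.
  by apply/measurable_EFinP; exact: measurable_normr_powR.
have S0 : 0 <= \sum_(1 <= i < N.+1) a i * A i `^ p.
  rewrite big_add1/= big_mkord; apply: sumr_ge0 => i _.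
  by rewrite mulr_ge0 ?powR_ge0// ltW// a_gt0.
have key : (\int[mu]_(y in I01) (`|D y| `^ p)%:E <=
   (\sum_(1 <= i < N.+1) a i * A i `^ p)%:E * \int[mu]_(t in I01) (`|W t| `^ p)%:E)%E.
  apply: (@le_trans _ _ (\int[mu]_(y in I01) (\sum_(i < N) (d i y)%:E))%E).
    apply: ae_ge0_le_integral.
    - exact: measurable_I01.
    - by move=> y _; rewrite lee_fin powR_ge0.
    - exact: measurable_normr_powR.
    - by move=> y _; apply: sume_ge0 => i _; rewrite lee_fin.
    - under eq_fun do rewrite sumEFin; apply/measurable_EFinP.
      by apply: (measurable_sumF (F := d)).
    have ax := @ae_forall_lt R (fun k y => y != x k) N.+1 (fun k _ => ae_neq (x k)).
    have aa : {ae mu, forall y, forall i, (i < N)%N ->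
       I01 ((y - b i.+1) / a i.+1) -> `|alpha i.+1 ((y - b i.+1) / a i.+1)| <= A i.+1}.
      apply: (@ae_forall_lt R (fun i y => I01 ((y - b i.+1) / a i.+1) ->
         `|alpha i.+1 ((y - b i.+1) / a i.+1)| <= A i.+1)) => i iN.
      have [_ h1] := ae_LinfNorm (@alpha_inf i.+1 iN).
      exact: (ae_affine (b i.+1) (a_gt0 iN) h1).
    apply: filterS3 ax aa GE => y yx ya yG yI.
    rewrite sumEFin lee_fin.
    have -> : D y = \sum_(i < N) alpha i.+1 ((y - b i.+1) / a i.+1) *
         (G ((y - b i.+1) / a i.+1) - Mn n h ((y - b i.+1) / a i.+1)) * \1_(piece i) y.
        by rewrite /D yG// addrAC subrr add0r big_add1/= big_mkord.
      apply: (@powR_norm_sum_le R N (fun i => alpha i.+1 ((y - b i.+1) / a i.+1) *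
         (G ((y - b i.+1) / a i.+1) - Mn n h ((y - b i.+1) / a i.+1)) * \1_(piece i) y)
         (fun i => d i y)) => //.
        move=> i j iN jN; rewrite !mulf_eq0 !negb_or => /andP[_ hi] /andP[_ hj].
        apply: (@piece_disjoint y) => //; first by move=> k kN; rewrite yx// ltnW.
          by move: hi; rewrite indicE; case: (boolP (y \in piece i)) => [/set_mem//|]; rewrite eqxx.
        by move: hj; rewrite indicE; case: (boolP (y \in piece j)) => [/set_mem//|]; rewrite eqxx.
      move=> i iN; rewrite /d indicE; case: (boolP (y \in piece i)) => yi; last first.
        by rewrite !mulr0 normr0 powR0 ?gt_eqF.
      rewrite !mulr1 -powRM ?A_ge0//.
      have ai := a_gt0 iN.
      set t := (y - b i.+1) / a i.+1.
      have tI : 0 < t < 1.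
        move: yi => /set_mem; rewrite pieceE//= in_itv/= => /andP[y2 y3].
        have y2' : x i < y by rewrite lt_neqAle eq_sym yx// ltnW.
        have y3' : y < x i.+1 by rewrite lt_neqAle y3 andbT yx.
        rewrite /t divr_gt0 ?bE ?subr_gt0//= ltr_pdivrMr// mul1r aE// ltrD2r//.
      have tI' : I01 t by rewrite /I01/= in_itv/=; case/andP: tI => /ltW -> /ltW ->.
      have AW : `|alpha i.+1 t * (G t - Mn n h t)| <= A i.+1 * `|W t|.
        rewrite normrM; apply: ler_pM => //; first exact: ya.
        have -> : G t - Mn n h t = D t - (Mn n h t - h t) by rewrite /D; ring.
        apply: le_trans (ler_normB _ _) _; apply: le_trans (ler_norm _).
        by rewrite /W lerD2l hE.
      by apply: ge0_ler_powR; rewrite ?nnegrE ?mulr_ge0 ?(ltW p0) ?A_ge0.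
  rewrite ge0_integral_sum; last 3 first.
  - exact: measurable_I01.
  - by move=> i; apply/measurable_EFinP; apply: md.
  - by move=> i y _; rewrite lee_fin.
  rewrite big_add1/= big_mkord -sumEFin ge0_sume_distrl; last first.
    by move=> i _; rewrite lee_fin mulr_ge0 ?powR_ge0// ltW// a_gt0.
  by apply: lee_sum => i _; rewrite integral_piece.
rewrite LpNormE [in leRHS]LpNormE.
have -> : Lambda%:E = ((\sum_(1 <= i < N.+1) a i * A i `^ p)%:E `^ p^-1)%E by [].
rewrite -poweRM ?lee_fin//; last by apply: integral_ge0 => t _; rewrite lee_fin powR_ge0.
apply: gt0_ler_poweR; last exact: key.
- by rewrite invr_ge0 ltW.
- by rewrite in_itv/= leey andbT; apply: integral_ge0 => t _; rewrite lee_fin powR_ge0.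
- rewrite in_itv/= leey andbT mule_ge0//.
  by apply: integral_ge0 => t _; rewrite lee_fin powR_ge0.
Qed.

Hypothesis Lambda1 : Lambda < 1.

Lemma fractal_error n (h G E : R -> R) e :
  is_alpha_fractal p N a b alpha n h G -> inLp p h ->
  measurable_fun I01 E -> (forall t, 0 < t < 1 -> `|Mn n h t - h t| <= E t) ->
  (LpNorm p E <= e%:E)%E ->
  (LpNorm p (fun y => (G y - h y)%R) <= (Lambda / (1 - Lambda) * e)%:E)%E.
Proof.
move=> GE [mh fh] mE hE Ee; have [[mG fG] _] := GE.
have L0 : 0 <= Lambda by exact: powR_ge0.
have mD : measurable_fun I01 (fun y => G y - h y) by exact: measurable_funB.
have mNh : measurable_fun I01 (fun y => -1 * h y) by exact: measurable_funM.
have mnD : measurable_fun I01 (fun y => `|G y - h y|) by exact: measurableT_comp.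
(* Finiteness, from G in L^p, is what allows ‖G - h‖ to be moved to the left of the contraction
   inequality. *)
have fD : (LpNorm p (fun y => (G y - h y)%R) < +oo)%E.
  rewrite (@eq_LpNorm _ p _ (fun y => G y + -1 * h y)); last by move=> y _; rewrite mulN1r.
  apply: le_lt_trans (LpNormD p1 mG mNh) _.
  by rewrite LpNormZ// normrN normr1 mul1e lte_add_pinfty.
have D0 : (0 <= LpNorm p (fun y => (G y - h y)%R))%E by exact: LpNorm_ge0.
have nD : (LpNorm p (fun y => `|G y - h y|%R) <= LpNorm p (fun y => (G y - h y)%R))%E.
  by apply: le_LpNorm => // y _; rewrite normr_id.
have := fractal_contraction GE mh mE hE.
have : (LpNorm p (fun y => (`|G y - h y| + E y)%R) <=
        LpNorm p (fun y => (G y - h y)%R) + e%:E)%E.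
  by apply: le_trans (LpNormD p1 mnD mE) _; apply: leeD.
move: fD D0; case: (LpNorm p (fun y => (G y - h y)%R)) => [D| |]// _; rewrite lee_fin => D0 h1 h2.
have := le_trans h2 (lee_wpmul2l _ h1); rewrite -EFinD -EFinM !lee_fin => /(_ L0) h3.
have l0 : 0 < 1 - Lambda by rewrite subr_gt0.
rewrite mulrAC ler_pdivlMr//; lra.
Qed.

End fractal_estimate.

(** * Conclusion *)

Section muntz_poly.
Context {R : realType}.

Lemma nneseries_pinfty_ge (u : nat -> R) : (forall j, 0 <= u j) ->
  (\sum_(j <oo) (u j)%:E = +oo)%E -> forall B, exists m, B <= \sum_(j < m) u j.
Proof.
move=> u0 uoo B; apply: contrapT => /forallNP h.
suff : (\sum_(j <oo) (u j)%:E <= B%:E)%E by rewrite uoo.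
apply: lime_le; first by apply: is_cvg_nneseries => j _ _; rewrite lee_fin.
apply: nearW => m; rewrite big_mkord sumEFin lee_fin.
by have /negP := h m; rewrite -ltNge => /ltW.
Qed.

Lemma exp_closure_sum (mu : nat -> R) n (F : nat -> R -> R) :
  (forall i, exp_closure mu (F i)) -> exp_closure mu (fun y => \sum_(i < n) F i y).
Proof.
move=> hF; elim: n => [|n IH].
  move=> eps e0; exists 0%N, (fun=> 0) => y y0.
  by rewrite !big_ord0 subr0 normr0 divr_ge0 ?(ltW e0)// exprn_ge0// addr_ge0.
under eq_fun do rewrite big_ord_recr/=.
by apply: exp_closureD.
Qed.

(** With y = - ln x, x^(1/p) x^i becomes exp(-(i + 1/p) y), whose exponent is positive even for the
    constant monomial. *)
Lemma muntz_poly p (lam : nat -> R) (P : {poly R}) e : 1 <= p ->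
  injective lam -> (forall i, - p^-1 < lam i) ->
  (\sum_(i <oo) ((lam i + p^-1) / ((lam i + p^-1) ^+ 2 + 1))%:E = +oo)%E -> 0 < e ->
  exists m (c : nat -> R),
    (LpNorm p (fun x => (P.[x] - \sum_(j < m) c j * x `^ lam j)%R) <= e%:E)%E.
Proof.
move=> p1 lam_inj lamp lamoo e0; have p0 : 0 < p by exact: lt_le_trans p1.
have lam0 j : 0 < lam j + p^-1 by have := lamp j; lra.
have lamB := nneseries_pinfty_ge
  (fun j => divr_ge0 (ltW (lam0 j)) (addr_ge0 (sqr_ge0 (lam j + p^-1)) ler01)) lamoo.
have lam_inj' : injective (fun j => lam j + p^-1) by move=> i j /addIr /lam_inj.
have H := muntz_exp lam_inj' lam0 lamB.
have mP : measurable_fun I01 (fun x => P.[x]).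
  apply: measurable_funTS; apply: continuous_measurable_fun; exact: continuous_horner.
apply: (@LpNorm_exp_closure R p lam (fun x => P.[x])
  (fun y => \sum_(i < size P) P`_i * expR (- (i%:R + p^-1) * y))) => //; last first.
  apply: (@exp_closure_sum _ (size P) (fun i y => P`_i * expR (- (i%:R + p^-1) * y))) => i.
  by apply: exp_closure_scale; apply: H; rewrite ltr_wpDl// invr_gt0.
move=> x /andP[x0 x1]; rewrite horner_coef mulr_sumr; apply: eq_bigr => i _.
rewrite mulrNN mulrDl expRD -powR_mulrn ?(ltW x0)// /powR gt_eqF//; ring.
Qed.

End muntz_poly.

Unset Implicit Arguments.
Set Strict Implicit.
Set Printing Implicit Defensive.

Theorem theorem6p4 (R : realType) (p : R) (N : nat) (x : nat -> R)
  (a b : nat -> R) (alpha : nat -> R -> R) (lam : nat -> R)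
  (G : nat -> nat -> R -> R) :
  1 <= p ->
  x 0%N = 0 -> x N = 1 -> (forall i, (i < N)%N -> x i < x i.+1) ->
  (forall i, (1 <= i <= N)%N -> a i * 0 + b i = x i.-1 /\ a i * 1 + b i = x i) ->
  (forall i, (1 <= i <= N)%N -> inLinf (alpha i)) ->
  powR (\sum_(1 <= i < N.+1) a i * powR (fine (LinfNorm (alpha i))) p) p^-1 < 1 ->
  injective lam ->
  (forall i, - p^-1 < lam i) ->
  (\sum_(i <oo) ((lam i + p^-1) / ((lam i + p^-1) ^+ 2 + 1))%:E = +oo)%E ->
  (* G n j is (a representative of) (x^{lam_j})^alpha_n *)
  (forall n j, (1 <= n)%N ->
     is_alpha_fractal p N a b alpha n (fun t => powR t (lam j)) (G n j)) ->
  (* density of S in L^p(I) *)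
  forall (f : R -> R) (eps : R), inLp p f -> 0 < eps ->
  exists (n m : nat) (c : nat -> R), (1 <= n)%N /\ (1 <= m)%N /\
    (LpNorm p (fun y => (f y - \sum_(0 <= j < m.+1) c j * G n j y)%R) < eps%:E)%E.
Proof.

move=> p1 x0 xN x_incr ab alpha_inf Lambda1 lam_inj lamp lamoo GE f eps fLp eps0.
have p0 : 0 < p by exact: lt_le_trans p1.
have [mf ff] := fLp.
set Lambda := powR _ _ in Lambda1.
pose K := Lambda / (1 - Lambda).
have K0 : 0 <= K by rewrite divr_ge0 ?powR_ge0// subr_ge0 ltW.
have eps4 : 0 < eps / 4 by rewrite divr_gt0.
have [P hP] := LpNorm_poly_dense p1 fLp eps4.
have [m [c hc]] := muntz_poly P p1 lam_inj lamp lamoo eps4.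
(* S d = eps/4 dominates the sum of the |c_j| K d; the summand 1 keeps S positive. *)
pose S := 1 + K * \sum_(j < m) `|c j|.
have S0 : 0 < S by rewrite ltr_pwDl// mulr_ge0// sumr_ge0.
pose d := eps / (4 * S).
have d0 : 0 < d by rewrite divr_gt0// mulr_gt0.
have /boolp.choice[n0 hn0] := fun j => Mn_powR_Lp p1 (lamp j) d0.
(* The coefficients do not depend on n, so one n can serve all the powers in the combination. *)
pose n := (\max_(j < m) n0 j)%N.
have mpow j : measurable_fun I01 (fun y : R => y `^ lam j) by exact: measurable_powR_id.
have mG j : measurable_fun I01 (G n.+1 j) by have [[]] := GE n.+1 j isT.
have mGp j : measurable_fun I01 (fun y => G n.+1 j y - y `^ lam j).
  exact: measurable_funB.
have err j : (j < m)%N ->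
    (LpNorm p (fun y => (G n.+1 j y - y `^ lam j)%R) <= (K * d)%:E)%E.
  move=> jm; have [|E [mE hE Ed]] := hn0 j n.
    exact: (leq_bigmax (Ordinal jm) (F := fun i : 'I_m => n0 i)).
  apply: (fractal_error p1 x0 xN x_incr ab alpha_inf Lambda1
    (h := fun t => powR t (lam j)) (GE n.+1 j isT) _ mE hE Ed); split => //.
  exact: le_lt_trans (LpNorm_powR_le p0 (lamp j)) (ltry _).
(* The span runs over the indices 0 to [m.+1], two more than the combination uses; both get
   coefficient 0, which also covers m = 0. *)
exists n.+1, m.+1, (fun j => if (j < m)%N then c j else 0); do 2 split => //.
pose F j y := - c j * (G n.+1 j y - y `^ lam j).
have mF j : measurable_fun I01 (F j) by exact: measurable_funM.
rewrite (@eq_LpNorm _ p _ (fun y => (f y - P.[y]) +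
  ((P.[y] - \sum_(j < m) c j * y `^ lam j) + \sum_(j < m) F j y))); last first.
  move=> y _; rewrite big_mkord !big_ord_recr/= ltnn ltnNge leqnSn !mul0r !addr0.
  under eq_bigr do rewrite ltn_ord.
  have -> : \sum_(j < m) F j y =
      \sum_(j < m) c j * y `^ lam j - \sum_(j < m) c j * G n.+1 j y.
    by rewrite -sumrB; apply: eq_bigr => j _; rewrite /F; ring.
  ring.
have mP : measurable_fun I01 (fun x => P.[x]).
  apply: measurable_funTS; apply: continuous_measurable_fun; exact: continuous_horner.
have m1 : measurable_fun I01 (fun y => f y - P.[y]) by exact: measurable_funB.
have m2 : measurable_fun I01 (fun y => P.[y] - \sum_(j < m) c j * y `^ lam j).
  apply: measurable_funB => //; apply: (measurable_sumF (F := fun j y => c j * y `^ lam j)).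
  by move=> j _; exact: measurable_funM.
have m3 : measurable_fun I01 (fun y => \sum_(j < m) F j y).
  by apply: (measurable_sumF (F := F)).
have sF : (LpNorm p (fun y => (\sum_(j < m) F j y)%R) <= (eps / 4)%:E)%E.
  apply: le_trans (LpNorm_sum p1 (fun j _ => mF j)) _.
  apply: (@le_trans _ _ (\sum_(j < m) (`|c j| * (K * d))%:E)%E).
    apply: lee_sum => j _; rewrite LpNormZ// normrN EFinM.
    by apply: lee_wpmul2l => //; exact: err.
  rewrite sumEFin lee_fin -mulr_suml.
  apply: (@le_trans _ _ (S * d)).
    by rewrite mulrA ler_wpM2r// ?(ltW d0)// /S mulrC lerDr.
  by rewrite /d le_eqVlt; apply/orP; left; apply/eqP; field; rewrite gt_eqF.
apply: (@le_lt_trans _ _ (eps / 4 + (eps / 4 + eps / 4))%:E); last by rewrite lte_fin; lra.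
rewrite !EFinD; apply: le_trans (LpNormD p1 m1 (measurable_funD m2 m3)) _.
apply: leeD => //; apply: le_trans (LpNormD p1 m2 m3) _; exact: leeD.
Qed.
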